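(* Let $q$ and $n$ be positive integers with $q\ge n$. Let the tropical holomorphic curve $f:\mathbb{R}\to\mathbb{TP}^n$ be tropical algebraically nondegenerate. Assume that tropical hypersurfaces $V_{P_j}$ are defined by homogeneous tropical polynomials $P_j$ $(j=1,\dots,q)$ of degree $d_j$, respectively, and let $d$ be the least common multiple of $d_1,\dots,d_q$. Let $M=\binom{n+d}{d}-1$. If $\lambda=\mathrm{ddg}(\{P_{M+2}\circ f,\dots,P_q\circ f\})$ and $$\limsup_{r\to\infty}\frac{\log T_f(r)}{r}=0,$$ then \begin{align*} (q-M-1-\lambda)T_f(r) &\le\sum_{j=1}^{q}\frac1{d_j}N\bigl(r,1_o\oslash(P_j\circ f)\bigr)-\frac1dN\Bigl(r,1_o\oslash C_o\bigl(P_1^{\odot\frac{d}{d_1}}\circ f,\dots,P_{M+1}^{\odot\frac{d}{d_{M+1}}}\circ f\bigr)\Bigr)+o(T_f(r))\\ &=\sum_{j=M+2}^{q}\frac1{d_j}N\bigl(r,1_o\oslash(P_j\circ f)\bigr)+o(T_f(r))\\ &\le(q-M-1)T_f(r)+o(T_f(r)), \end{align*} where $r$ approaches infinity outside an exceptional set of zero upper density measure. In the special case $\lambda=0$, \begin{align*} (q-M-1)T_f(r) &=\sum_{j=1}^{q}\frac1{d_j}N\bigl(r,1_o\oslash(P_j\circ f)\bigr)-\frac1dN\Bigl(r,1_o\oslash C_o\bigl(P_1^{\odot\frac{d}{d_1}}\circ f,\dots,P_{M+1}^{\odot\frac{d}{d_{M+1}}}\circ f\bigr)\Bigr)+o(T_f(r))\\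 &=\sum_{j=M+2}^{q}\frac1{d_j}N\bigl(r,1_o\oslash(P_j\circ f)\bigr)+o(T_f(r)), \end{align*} where $r$ approaches infinity outside an exceptional set of zero upper density measure.
   Context: Tropical semiring: $\mathbb{R}_{\max}=\mathbb{R}\cup\{-\infty\}$ with $x\oplus y=\max(x,y)$, $x\odot y=x+y$, $x\oslash y=x-y$, $x^{\odot a}=ax$, $0_o=-\infty$, $1_o=0$. $\mathbb{TP}^n$ is $\mathbb{R}_{\max}^{n+1}\setminus\{(0_o,\dots,0_o)\}$ modulo $(a_0,\dots,a_n)\sim(\mu+a_0,\dots,\mu+a_n)$, $\mu\in\mathbb{R}$. A tropical meromorphic function is a continuous piecewise linear $f:\mathbb{R}\to\mathbb{R}$ (possibly infinitely many pieces, derivative discontinuities locally finite). With $\omega_f(x)=\lim_{\varepsilon\to0+}\{f'(x+\varepsilon)-f'(x-\varepsilon)\}$, $x$ is a zero of multiplicity $\omega_f(x)$ if $\omega_f(x)>0$ and a pole of multiplicity $-\omega_f(x)$ if $\omega_f(x)<0$. A tropical entire function is a tropical meromorphic function without poles (equivalently, convex). $n(r,f)$ is the number of poles of $f$ in $(-r,r)$ counted with multiplicity, and $N(r,f)=\frac12\int_0^r n(t,f)\,dt$. So $N(r,1_o\oslash h)$, where $1_o\oslash h=-h$, counts the zeros of $h$. A tropical holomorphic curve $f=[f_0:\dots:f_n]:\mathbb{R}\to\mathbb{TP}^n$ is given by a reduced representation $(f_0,\dots,f_n)$ of tropical entire functions with no zero common to all of them. With $\|f(x)\|=\max_j f_j(x)$,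 $T_f(r)=\frac12[\|f(r)\|+\|f(-r)\|]-\|f(0)\|$ (independent of the reduced representation). A homogeneous tropical polynomial of degree $d$ is $P(x)=\bigoplus_{i_0+\dots+i_n=d}c_{i_0,\dots,i_n}\odot x_0^{\odot i_0}\odot\cdots\odot x_n^{\odot i_n}$ with $c_{i_0,\dots,i_n}\in\mathbb{R}_{\max}$ not all $0_o$, $i_k\in\mathbb{N}_0$. The tropical hypersurface $V_P$ is the set of points at which the maximum defining $P$ is attained by at least two monomials. $P\circ f=P(f_0,\dots,f_n)$, and $P^{\odot s}=s\cdot P$ as a function. $f$ is tropical algebraically nondegenerate if $f(\mathbb{R})\not\subset V_P$ for every tropical hypersurface $V_P$ in $\mathbb{TP}^n$ (of any degree). Let $I_0,\dots,I_M$ enumerate the exponents $(i_0,\dots,i_n)\in\mathbb{N}_0^{n+1}$ with $i_0+\dots+i_n=d$, and $f^{I}=f_0^{\odot i_0}\odot\cdots\odot f_n^{\odot i_n}$ for $I=(i_0,\dots,i_n)$. For $F=\bigoplus_{k=0}^M a_k\odot f^{I_k}$, $a_k\in\mathbb{R}_{\max}$, not identically $0_o$, $\hat\ell(F)$ is the smallest $j\in\{1,\dots,M+1\}$ such that $F=\bigoplus_{i=1}^j b_{i}\odot f^{I_{k_i}}$ for some $0\le k_1<\dots<k_j\le M$ and real $b_i$. $F$ is complete if $\hat\ell(F)=M+1$. The degree of degeneracy $\mathrm{ddg}(Q)$ of a collection $Q$ of such $F$ is the number of non-complete elements of $Q$. Here the elements are indexed by $j=M+2,\dots,q$, and when $d_j<d$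 the completeness of $P_j\circ f$ is that of $P_j^{\odot d/d_j}\circ f$, which is a combination of the $f^{I_k}$. Fix $c\in\mathbb{R}\setminus\{0\}$. The tropical Casoratian of $g_0,\dots,g_M$ is $C_o(g_0,\dots,g_M)(x)=\max_\pi\sum_{k=0}^M g_k(x+\pi(k)c)$, the maximum over all permutations $\pi$ of $\{0,\dots,M\}$. The statement involves $P_1,\dots,P_{M+1}$ and so presupposes $q\ge M+1$. A set $E$ has zero upper density measure if $\limsup_{r\to\infty}\frac1r\int_{E\cap[1,r]}dt=0$. *)

(* Defs.v *)
From HB Require Import structures.
From mathcomp Require Import all_boot all_order all_algebra perm.
From mathcomp Require Import all_classical all_reals all_analysis.

Set Implicit Arguments.
Unset Strict Implicit.
Unset Printing Implicit Defensive.

Import Order.TTheory GRing.Theory Num.Theory.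
Import numFieldNormedType.Exports.

Local Open Scope classical_set_scope.
Local Open Scope ring_scope.

(* The tropical semiring R_max is rendered inside \bar R, by excluding +oo;
   there 0_o = -oo, 1_o = 0, the tropical sum is maxe, the tropical product is
   +%E, and the tropical power x^{(.) i} with i : nat is x *+ i (in particular
   -oo *+ 0 = 0). *)

Section OneVariable.
Context {R : realType}.
Implicit Types f g h : R -> R.

Definition locally_finite (D : set R) : Prop :=
  forall a b : R, finite_set (D `&` `[a, b]).

Definition piecewise_linear f : Prop :=
  exists2 D : set R, locally_finite D &
    forall a b : R, `]a, b[ `&` D = set0 ->
      exists m k : R, forall x, x \in `]a, b[ -> f x = m * x + k.

Definition tropical_meromorphic f : Prop := continuous f /\ piecewise_linear f.

Definition omega f (x : R) : R :=
  lim ((fun e : R => derive1 f (x + e) - derive1 f (x - e)) @ 0^'+).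

Definition is_zero f (x : R) : Prop := 0 < omega f x.

Definition is_pole f (x : R) : Prop := omega f x < 0.

Definition tropical_entire f : Prop :=
  tropical_meromorphic f /\ forall x, ~ is_pole f x.

(* Multiplicities are real numbers, since slopes are.  The sum is over a finite
   set whenever f is tropical meromorphic. *)
Definition pole_count (r : R) f : R :=
  \sum_(x \in [set x : R | - r < x < r /\ is_pole f x]) - omega f x.

Definition Ncount (r : R) f : R :=
  2^-1 * \int[lebesgue_measure]_(t in `[0, r]) pole_count t f.

(* 1_o (/) h *)
Definition tinv h : R -> R := fun x => 0 - h x.

(* h^{(.) s} *)
Definition tpow h (s : nat) : R -> R := fun x => s%:R * h x.

Definition casoratian_term (c : R) (M : nat) (g : 'I_M.+1 -> R -> R) (x : R)
    (s : 'S_M.+1) : R :=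
  \sum_(k < M.+1) g k (x + (s k)%:R * c).

(* The default value of the iterated maximum is its term at the identity. *)
Definition casoratian (c : R) (M : nat) (g : 'I_M.+1 -> R -> R) : R -> R :=
  fun x => \big[Num.max/casoratian_term c g x 1%g]_(s : 'S_M.+1)
             casoratian_term c g x s.

Definition zero_upper_density (E : set R) : Prop :=
  measurable E /\
  limf_esup (fun r : R =>
    (r^-1)%:E * \int[lebesgue_measure]_(t in E `&` `[1%R, r]) 1)%E
    (pinfty_nbhs R) = 0%E.

(* r --> +oo outside E *)
Definition infty_outside (E : set R) : filter_on R :=
  FilterType (within (~` E) (pinfty_nbhs R)) (within_filter _ _).

Definition eq_o (E : set R) (T A B : R -> R) : Prop :=
  exists2 h : R -> R, h =o_ (infty_outside E) T &
    \forall r \near infty_outside E, A r = B r + h r.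

Definition le_o (E : set R) (T A B : R -> R) : Prop :=
  exists2 h : R -> R, h =o_ (infty_outside E) T &
    \forall r \near infty_outside E, A r <= B r + h r.

End OneVariable.

Definition expo (n d : nat) : Type :=
  {I : {ffun 'I_n.+1 -> 'I_d.+1} | (\sum_(k < n.+1) (I k : nat) == d)%N}.
HB.instance Definition _ n d := Finite.on (expo n d).

Section SeveralVariables.
Context {R : realType} {n : nat}.

(* Homogeneous coordinates of points of TP^n. *)
Definition tproj_coord (x : 'I_n.+1 -> \bar R) : Prop :=
  (forall k, x k != +oo%E) /\ exists k, x k != -oo%E.

Definition tmonomial (d : nat) (I : expo n d) (x : 'I_n.+1 -> \bar R) : \bar R :=
  (\sum_(k < n.+1) x k *+ val I k)%E.

End SeveralVariables.

Record tpoly (R : realType) (n d : nat) := TPoly {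
  coef : expo n d -> \bar R;
  coef_Rmax : forall I, coef I != +oo%E;
  coef_nonzero : exists I, coef I != -oo%E }.

Section Curves.
Context {R : realType} {n : nat}.
Implicit Type f : 'I_n.+1 -> R -> R.

Definition teval (d : nat) (P : tpoly R n d) (x : 'I_n.+1 -> \bar R) : \bar R :=
  \big[maxe/-oo%E]_(I : expo n d) (coef P I + tmonomial I x)%E.

(* V_P, as a set of homogeneous coordinates; by homogeneity of P it is
   invariant under x |-> (mu + x_0, ..., mu + x_n). *)
Definition hypersurface (d : nat) (P : tpoly R n d) : set ('I_n.+1 -> \bar R) :=
  [set x | tproj_coord x /\
     exists I J : expo n d, [/\ I != J,
       (coef P I + tmonomial I x)%E = teval P x &
       (coef P J + tmonomial J x)%E = teval P x]].

Definition reduced_representation f : Prop :=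
  (forall j, tropical_entire (f j)) /\
  ~ exists x, forall j, is_zero (f j) x.

Definition curve_point f (x : R) : 'I_n.+1 -> \bar R := fun k => (f k x)%:E.

Definition tnorm f (x : R) : R := \big[Num.max/f ord0 x]_(j < n.+1) f j x.

Definition Tchar f (r : R) : R :=
  2^-1 * (tnorm f r + tnorm f (- r)) - tnorm f 0.

Definition alg_nondegenerate f : Prop :=
  forall (e : nat) (P : tpoly R n e), ~ (range (curve_point f) `<=` hypersurface P).

(* The value is finite, as the f_k are real-valued and some coefficient of P
   is finite. *)
Definition tcomp (d : nat) (P : tpoly R n d) f : R -> R :=
  fun x => fine (teval P (curve_point f x)).

(* F is a combination, with real coefficients, of j of the f^I with |I| = d. *)
Definition combination f (d : nat) (F : R -> R) (j : nat) : Prop :=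
  exists S : {set expo n d}, #|S| = j /\
  exists b : expo n d -> R, forall x,
    (F x)%:E =
      \big[maxe/-oo%E]_(I in S) ((b I)%:E + tmonomial I (curve_point f x))%E.

(* j = \hat\ell(F) *)
Definition is_ell_hat f (d : nat) (F : R -> R) (j : nat) : Prop :=
  [/\ (0 < j)%N, combination f d F j &
      forall i, (0 < i)%N -> combination f d F i -> (j <= i)%N].

(* 'C(n + d, d) = M + 1 is the number of exponents of degree d. *)
Definition complete f (d : nat) (F : R -> R) : Prop :=
  is_ell_hat f d F 'C(n + d, d).

Definition ddg f (d : nat) (J : finType) (A : {set J}) (Q : J -> R -> R) : nat :=
  #|[set j in A | ~~ `[< complete f d (Q j) >]]|.

End Curves.

(* Main.v *)
(** In this setting Jensen's formula says that, for a convex piecewise linear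
    [h], the counting function of its zeros [N(r, 1_o (/) h)] equals the
    symmetric mean [(h r + h (- r)) / 2 - h 0].  Compositions [P_j o f] and
    their Casoratian are convex and piecewise linear, so every term of the
    theorem is such a mean.  From above, [P_j o f <= d_j ||f|| + O(1)]; if
    [P_j o f] is complete then every pure power [f_k^d] occurs in it with a
    finite coefficient, hence also [P_j o f >= d_j ||f|| - O(1)].  Algebraic
    nondegeneracy forces [T_f] to grow at least linearly, which absorbs the
    [O(1)].  The Casoratian is a maximum of sums of shifts, so it differs from
    the sum of its entries by at most the increments of these entries over a
    bounded step; since [log T_f(r) = o(r)], these are [o(T_f(r))] outside a set
    of zero upper density. *)
Require Import Defs.
From mathcomp Require Import all_boot all_order all_algebra perm.
From mathcomp Require Import all_classical all_reals all_analysis.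
From mathcomp Require Import ring lra.

Set Implicit Arguments.
Unset Strict Implicit.
Unset Printing Implicit Defensive.

Import Order.TTheory GRing.Theory Num.Theory.
Import numFieldNormedType.Exports.

Local Open Scope classical_set_scope.
Local Open Scope ring_scope.

(** * Convex piecewise linear functions *)

Section ConvexPiecewiseLinear.
Context {R : realType}.
Implicit Types (g h : R -> R) (a b p r t u v x y z : R).

(** [a] is the slope to the left of [x] and [b] the jump of the slope there. *)
Definition corner h x a b : Prop :=
  \forall y \near x, h y = h x + a * (y - x) + b * Num.max 0 (y - x).

(** A purely local condition, which passes to sums, shifts and maxima without tracking breakpoints;
    their finiteness on compact intervals is recovered in [convex_pl_hinge_sum]. *)
Definition convex_pl h : Prop :=
  forall x, exists a b, 0 <= b /\ corner h x a b.

Lemma max0_ge x : 0 <= x -> Num.max 0 x = x.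
Proof. by move=> x0; rewrite max_r. Qed.

Lemma max0_le x : x <= 0 -> Num.max 0 x = 0.
Proof. by move=> x0; rewrite max_l. Qed.

Lemma maxr_max0 u v : Num.max u v = u + Num.max 0 (v - u).
Proof.
case: (leP u v) => uv; first by rewrite max0_ge; lra.
by rewrite max0_le; lra.
Qed.

Lemma corner_continuous h x a b : corner h x a b -> {for x, continuous h}.
Proof.
move=> hc; rewrite /prop_for /continuous_at.
have cmax : {for x, continuous (fun y => h x + a * (y - x) + b * Num.max 0 (y - x))}.
  apply: continuousD; last first.
    apply: continuousM; first exact: cst_continuous.
    apply: continuous_max; first exact: cst_continuous.
    by apply: continuousB => //; exact: cst_continuous.
  apply: continuousD; first exact: cst_continuous.
  apply: continuousM; first exact: cst_continuous.
  by apply: continuousB => //; exact: cst_continuous.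
move: cmax; rewrite /prop_for /continuous_at subrr maxxx !mulr0 !addr0.
apply: cvg_trans; apply: near_eq_cvg.
by apply: filterS hc => y ->.
Qed.

Lemma convex_pl_affine a b : convex_pl (fun y => a * y + b).
Proof.
move=> x; exists a, 0; split=> //.
by near=> y; rewrite mul0r; ring.
Unshelve. all: by end_near. Qed.

Lemma convex_plD g h : convex_pl g -> convex_pl h -> convex_pl (g \+ h).
Proof.
move=> hg hh x; have [a [b [b0 cg]]] := hg x; have [a' [b' [b'0 ch]]] := hh x.
exists (a + a'), (b + b'); split; first lra.
by apply: filterS2 cg ch => y /= -> ->; ring.
Qed.

Lemma convex_plZ k h : 0 <= k -> convex_pl h -> convex_pl (fun y => k * h y).
Proof.
move=> k0 hh x; have [a [b [b0 ch]]] := hh x.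
exists (k * a), (k * b); split; first exact: mulr_ge0.
by apply: filterS ch => y /= ->; ring.
Qed.

Lemma convex_pl_shift t h : convex_pl h -> convex_pl (fun y => h (y + t)).
Proof.
move=> hh x; have [a [b [b0 ch]]] := hh (x + t).
exists a, b; split=> //.
move: ch => /nbhs_ballP[e /= e0 he]; apply/nbhs_ballP; exists e => // y.
rewrite /ball/= => xy; rewrite (_ : y - x = (y + t) - (x + t)); last by ring.
apply: he; rewrite /ball/=; suff -> : x + t - (y + t) = x - y by [].
by ring.
Qed.

Lemma convex_pl_sum (I : Type) (s : seq I) (F : I -> R -> R) :
  (forall i, convex_pl (F i)) -> convex_pl (fun y => \sum_(i <- s) F i y).
Proof.
move=> hF; elim: s => [|i s IH].
  have -> : (fun y => \sum_(i <- [::]) F i y) = (fun y => 0 * y + 0).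
    by apply/funext => y; rewrite big_nil mul0r addr0.
  exact: convex_pl_affine.
have -> : (fun y => \sum_(j <- i :: s) F j y) =
          F i \+ (fun y => \sum_(i <- s) F i y).
  by apply/funext => y; rewrite big_cons.
exact: convex_plD.
Qed.

Lemma convex_pl_max_gt g h x : convex_pl g -> convex_pl h -> h x < g x ->
  exists a b, 0 <= b /\ corner (fun y => Num.max (g y) (h y)) x a b.
Proof.
move=> hg hh hgx; have [a [b [b0 cg]]] := hg x; have [a' [b' [b'0 ch]]] := hh x.
exists a, b; split=> //.
have /continuousB /(_ (corner_continuous ch)) gh := corner_continuous cg.
have : \forall y \near x, 0 < (g - h) y.
  by apply: (cvgr_gt _ gh); rewrite /= !fctE subr_gt0.
rewrite /corner (max_l (ltW hgx)).
apply: filterS2 cg => y <-; rewrite !fctE subr_gt0 => hgy.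
by rewrite max_l// ltW.
Qed.

(** Away from a crossing the maximum is locally one of the two functions. At a crossing its left
    slope is the smaller left slope, because [y - x] is negative there, and its right slope is the
    larger right slope. *)
Lemma convex_pl_max g h : convex_pl g -> convex_pl h ->
  convex_pl (fun y => Num.max (g y) (h y)).
Proof.
move=> hg hh x; have [gh|hgx|gh] := ltgtP (g x) (h x).
- have -> : (fun y => Num.max (g y) (h y)) = (fun y => Num.max (h y) (g y)).
    by apply/funext => y; rewrite maxC.
  exact: convex_pl_max_gt.
- exact: convex_pl_max_gt.
have [a [b [b0 cg]]] := hg x; have [a' [b' [b'0 ch]]] := hh x.
exists (Num.min a a'), (Num.max (a + b) (a' + b') - Num.min a a').
split.
  by rewrite subr_ge0 ge_min le_max; case: (leP a a') => ?; apply/orP;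
     left; apply/orP; left; lra.
rewrite /corner gh maxxx.
apply: filterS2 cg ch => y -> ->; rewrite gh.
have [yx|yx] := leP x y.
  rewrite (max0_ge (_ : 0 <= y - x)); last lra.
  rewrite -!addrA -!mulrDl -addr_maxr -maxr_pMl; last lra.
  by congr (_ + _ * _); ring.
rewrite max0_le; last lra.
rewrite !mulr0 !addr0 -addr_maxr; congr (_ + _).
have [aa|aa] := leP a a'.
  by rewrite max_l// ler_wnM2r//; lra.
by rewrite max_r// ler_wnM2r//; lra.
Qed.

Lemma convex_pl_bigmax (I : Type) (s : seq I) g (F : I -> R -> R) :
  convex_pl g -> (forall i, convex_pl (F i)) ->
  convex_pl (fun y => \big[Num.max/g y]_(i <- s) F i y).
Proof.
move=> hg hF; elim: s => [|i s IH].
  by have -> : (fun y => \big[Num.max/g y]_(i <- [::]) F i y) = g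
    by apply/funext => y; rewrite big_nil.
have -> : (fun y => \big[Num.max/g y]_(j <- i :: s) F j y) =
          (fun y => Num.max (F i y) (\big[Num.max/g y]_(j <- s) F j y)).
  by apply/funext => y; rewrite big_cons.
exact: convex_pl_max.
Qed.

Lemma derive1_affine h y a b :
  (\forall z \near y, h z = a * z + b) -> derive1 h y = a.
Proof.
move=> ha; rewrite derive1E.
rewrite (@near_eq_derive _ _ _ h (fun z => a * z + b)) ?oner_neq0//.
have : is_derive y (1:R) (fun z => a * z + b) a.
  have : is_derive y (1 : R) ((a *: id) + cst b) (a *: 1 + 0) by exact: is_deriveD.
  by rewrite addr0 /GRing.scale/= mulr1.
by case.
Qed.

Lemma omega_corner h x a b : corner h x a b -> omega h x = b.
Proof.
move=> /nbhs_ballP[e /= e0 he]; rewrite /omega; apply: lim_near_cst => //.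
near=> t.
have t0 : 0 < t by near: t; exact: nbhs_right_gt.
have te : t < e / 2.
  by near: t; apply: nbhs_right_lt; lra.
have -> : derive1 h (x + t) = a + b.
  apply: (@derive1_affine _ _ _ (h x - (a + b) * x)).
  apply/nbhs_ballP; exists t => //= y; rewrite /ball/= ltr_norml => /andP[y1 y2].
  rewrite he; last by rewrite /ball/= ltr_norml; apply/andP; split; lra.
  by rewrite max0_ge; [ring|lra].
have -> : derive1 h (x - t) = a.
  apply: (@derive1_affine _ _ _ (h x - a * x)).
  apply/nbhs_ballP; exists t => //= y; rewrite /ball/= ltr_norml => /andP[y1 y2].
  rewrite he; last by rewrite /ball/= ltr_norml; apply/andP; split; lra.
  by rewrite max0_le; [ring|lra].
ring.
Unshelve. all: by end_near. Qed.

(** A finite set is closed, so a punctured ball about [x] avoids the breakpoints. The two affine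
    pieces meet at [h x] by continuity, and the absence of poles makes the slope jump
    nonnegative. *)
Lemma tropical_entire_convex_pl h : tropical_entire h -> convex_pl h.
Proof.
move=> [[hcont [D hD hlin]] hpole] x.
have : \forall y \near x, ~ (D `&` `[x - 1, x + 1] `\ x) y.
  have : closed (D `&` `[x - 1, x + 1] `\ x).
    have /accessible_finite_set_closed := hausdorff_accessible (@Rhausdorff R).
    by apply; apply: finite_setD; exact: hD.
  move=> /closed_openC oD; apply: open_nbhs_nbhs; split=> //.
  by move=> [_ /=]; apply.
move=> /nbhs_ballP[e0 /= e00 he0].
pose e := Num.min e0 1.
have [e_gt0 ee0 e1] : [/\ 0 < e, e <= e0 & e <= 1].
  by rewrite /e lt_min e00 ltr01 ge_min lexx ge_min lexx orbT.
have noD y : `|x - y| < e -> y != x -> ~ D y.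
  move=> xy yx Dy; apply: (he0 y); first by rewrite /ball/=; lra.
  split; last by move=> /= /eqP; exact/negP.
  split=> //=; rewrite in_itv/=; move: xy; rewrite ltr_norml => /andP[? ?].
  by apply/andP; split; lra.
have [m [k hr]] : exists m k : R, forall y, y \in `]x, x + e[ -> h y = m * y + k.
  apply: hlin; rewrite -subset0 => y [/=]; rewrite in_itv/= => /andP[y1 y2].
  by apply: noD; [rewrite ltr_norml; apply/andP; split; lra | rewrite gt_eqF].
have [m' [k' hl]] :
    exists m k : R, forall y, y \in `]x - e, x[ -> h y = m * y + k.
  apply: hlin; rewrite -subset0 => y [/=]; rewrite in_itv/= => /andP[y1 y2].
  by apply: noD; [rewrite ltr_norml; apply/andP; split; lra | rewrite lt_eqF].
have cvaff (m0 k0 : R) : (fun y => m0 * y + k0) @ x --> m0 * x + k0.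
  apply: (@continuousD _ _ _ (fun y => m0 * y) (cst k0)); last exact: cst_continuous.
  by apply: (@continuousM _ _ (cst m0) id) => //; exact: cst_continuous.
have hxr : h x = m * x + k.
  have h1 : h @ x^'+ --> h x by apply: cvg_at_right_filter; exact: hcont.
  have h2 : (fun y => m * y + k) @ x^'+ --> m * x + k.
    exact/cvg_at_right_filter/cvaff.
  have h3 : h @ x^'+ --> m * x + k.
    apply: cvg_trans h2; apply: near_eq_cvg; near=> y.
    symmetry; apply: hr; rewrite in_itv/=; apply/andP; split.
      by near: y; exact: nbhs_right_gt.
    by near: y; apply: nbhs_right_lt; lra.
  exact: (cvg_unique _ h1 h3).
have hxl : h x = m' * x + k'.
  have h1 : h @ x^'- --> h x by apply: cvg_at_left_filter; exact: hcont.
  have h2 : (fun y => m' * y + k') @ x^'- --> m' * x + k'.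
    exact/cvg_at_left_filter/cvaff.
  have h3 : h @ x^'- --> m' * x + k'.
    apply: cvg_trans h2; apply: near_eq_cvg; near=> y.
    symmetry; apply: hl; rewrite in_itv/=; apply/andP; split.
      by near: y; apply: nbhs_left_gt; lra.
    by near: y; exact: nbhs_left_lt.
  exact: (cvg_unique _ h1 h3).
have hc : corner h x m' (m - m').
  apply/nbhs_ballP; exists e => //= y; rewrite /ball/= ltr_norml => /andP[y1 y2].
  have [yx|yx|<-] := ltgtP y x.
  - rewrite max0_le; last lra.
    by rewrite hl ?hxl; [ring | rewrite in_itv/=; apply/andP; split; lra].
  - rewrite max0_ge; last lra.
    rewrite hr ?in_itv/=; last by apply/andP; split; lra.
    have -> : h x + m' * (y - x) + (m - m') * (y - x) = h x + m * (y - x) by ring.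
    by rewrite hxr; ring.
  - by rewrite subrr maxxx !mulr0 !addr0.
exists m', (m - m'); split=> //.
by rewrite -(omega_corner hc) leNgt; apply/negP; exact: hpole.
Unshelve. all: by end_near. Qed.

End ConvexPiecewiseLinear.

(** * Jensen's formula *)

Section Jensen.
Context {R : realType}.
Implicit Types (g h L : R -> R) (s : seq (R * R)) (a b r t u v x y z : R).

(** Continuous induction, a form of the compactness of [[u, v]]: the local property at the supremum
    of the endpoints reachable from [u] would carry past it unless it is already [v]. *)
Lemma interval_induction (Q : R -> R -> Prop) :
  (forall u v w, u <= v -> v <= w -> Q u v -> Q v w -> Q u w) ->
  (forall x, exists2 e, 0 < e &
     forall u v, x - e < u -> u <= x -> x <= v -> v < x + e -> Q u v) ->
  forall u v, u <= v -> Q u v.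
Proof.
move=> Qglue Qloc u v uv.
pose S := [set w | u <= w <= v /\ Q u w].
have Su : S u.
  split; first by rewrite lexx.
  by have [e e0] := Qloc u; apply; lra.
have hasS : has_sup S by split; [exists u|exists v => w [/andP[]]].
pose m := sup S.
have um : u <= m by apply: ub_le_sup => //; case: hasS.
have mv : m <= v by apply: ge_sup; [exists u|move=> w [/andP[]]].
have [e e0 Qm] := Qloc m.
have [w [/andP[uw wv] Quw] wm] := sup_adherent e0 hasS.
have wm' : w <= m by apply: ub_le_sup; [case: hasS|split=> //; apply/andP].
have Qext z : m <= z -> z < m + e -> Q u z.
  move=> mz zme; apply: (Qglue u w z) => //; first lra.
  by apply: Qm => //; lra.
have [vm|mv'] := leP v m; first by apply: Qext => //; lra.
have ze : exists z, [/\ m < z, z < m + e & z <= v].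
  exists (Num.min v (m + e / 2)); rewrite lt_min gt_min ge_min lexx mv' orTb.
  by split=> //; [lra | apply/orP; right; lra].
have [z [mz zme zv]] := ze.
suff : z <= m by lra.
apply: ub_le_sup; first by case: hasS.
by split; [apply/andP; split; lra | apply: Qext => //; lra].
Qed.

(** Normal form on a compact interval; a pair in [s] is a breakpoint with a weight. Breakpoints may
    repeat and weights may be negative, so that sums and gluing need no normalisation. *)
Definition hinge_sum a b s y : R :=
  a + b * y + \sum_(p <- s) p.2 * Num.max 0 (y - p.1).

Definition is_hinge_sum h : Prop := exists a b s, h = hinge_sum a b s.

Lemma is_hinge_sum_affine a b : is_hinge_sum (fun y => a + b * y).
Proof.
exists a, b, [::]; apply/funext => y.
by rewrite /hinge_sum big_nil addr0.
Qed.

Lemma is_hinge_sum_hinge a p : is_hinge_sum (fun y => a * Num.max 0 (y - p)).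
Proof.
exists 0, 0, [:: (p, a)]; apply/funext => y.
by rewrite /hinge_sum big_seq1/= mul0r !add0r.
Qed.

Lemma is_hinge_sumD g h :
  is_hinge_sum g -> is_hinge_sum h -> is_hinge_sum (g \+ h).
Proof.
move=> [a [b [s ->]]] [a' [b' [s' ->]]]; exists (a + a'), (b + b'), (s ++ s').
by apply/funext => y; rewrite /hinge_sum big_cat/=; ring.
Qed.

Lemma is_hinge_sum_big s (F : R -> R -> R) :
  (forall p c, is_hinge_sum (fun y => c * F p y)) ->
  is_hinge_sum (fun y => \sum_(p <- s) p.2 * F p.1 y).
Proof.
move=> hF; elim: s => [|p s IH].
  have -> : (fun y => \sum_(p <- [::]) p.2 * F p.1 y) = (fun y => 0 + 0 * y).
    by apply/funext => y; rewrite big_nil mul0r addr0.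
  exact: is_hinge_sum_affine.
have -> : (fun y => \sum_(q <- p :: s) q.2 * F q.1 y) =
  (fun y => p.2 * F p.1 y) \+ (fun y => \sum_(p <- s) p.2 * F p.1 y).
  by apply/funext => y; rewrite big_cons.
exact: is_hinge_sumD.
Qed.

(** Passing to [max v y] freezes the function to the left of [v]: a hinge at [p <= v] turns into a
    constant plus a hinge at [v], and a hinge beyond [v] is unchanged. *)
Lemma is_hinge_sum_maxr v L :
  is_hinge_sum L -> is_hinge_sum (fun y => L (Num.max v y)).
Proof.
move=> [a [b [s ->]]].
have maxv c : is_hinge_sum (fun y => c + b * Num.max v y).
  have -> : (fun y => c + b * Num.max v y) =
    (fun y => (c + b * v) + 0 * y) \+ (fun y => b * Num.max 0 (y - v)).
    by apply/funext => y /=; rewrite maxr_max0; ring.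
  by apply: is_hinge_sumD; [exact: is_hinge_sum_affine|exact: is_hinge_sum_hinge].
have -> : (fun y => hinge_sum a b s (Num.max v y)) =
  (fun y => a + b * Num.max v y) \+
  (fun y => \sum_(p <- s) p.2 * Num.max 0 (Num.max v y - p.1)) by [].
apply: is_hinge_sumD => //.
apply: (@is_hinge_sum_big s (fun p y => Num.max 0 (Num.max v y - p))).
move=> p c; have [pv|vp] := leP p v.
  have -> : (fun y => c * Num.max 0 (Num.max v y - p)) =
    (fun y => c * (v - p) + 0 * y) \+ (fun y => c * Num.max 0 (y - v)).
    apply/funext => y /=; have [yv|yv] := leP v y.
      by rewrite !max0_ge; try lra; ring.
    by rewrite max0_ge ?max0_le; try lra; ring.
  by apply: is_hinge_sumD; [exact: is_hinge_sum_affine|exact: is_hinge_sum_hinge].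
have -> : (fun y => c * Num.max 0 (Num.max v y - p)) =
          (fun y => c * Num.max 0 (y - p)).
  apply/funext => y; have [//|yv] := leP v y.
  by rewrite !max0_le//; lra.
exact: is_hinge_sum_hinge.
Qed.

(** Follows from [is_hinge_sum_maxr] through [L (min v y) + L (max v y) = L v + L y]. *)
Lemma is_hinge_sum_minr v L :
  is_hinge_sum L -> is_hinge_sum (fun y => L (Num.min v y)).
Proof.
move=> hL.
have hLmax := is_hinge_sum_maxr v hL.
have hN g : is_hinge_sum g -> is_hinge_sum (fun y => - g y).
  move=> [a [b [s ->]]]; exists (- a), (- b), [seq (p.1, - p.2) | p <- s].
  apply/funext => y; rewrite /hinge_sum big_map/=.
  by under [in RHS]eq_bigr do rewrite mulNr; rewrite sumrN; ring.
have -> : (fun y => L (Num.min v y)) =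
  L \+ ((fun y => L v + 0 * y) \+ (fun y => - L (Num.max v y))).
  by apply/funext => y /=; case: (leP v y) => _; ring.
apply: is_hinge_sumD => //; apply: is_hinge_sumD; last exact: hN.
exact: is_hinge_sum_affine.
Qed.

(* Hinge sums [L1] on [[u, v]] and [L2] on [[v, w]] that agree at [v] glue to
   [L1 (min v y) + L2 (max v y) - L2 v], which is again a hinge sum. *)
Lemma convex_pl_hinge_sum h u v : convex_pl h -> u <= v ->
  exists2 L, is_hinge_sum L & forall y, u <= y <= v -> h y = L y.
Proof.
move=> hh; move: u v; apply: (@interval_induction (fun u v =>
  exists2 L, is_hinge_sum L & forall y, u <= y <= v -> h y = L y)).
  move=> u v w uv vw [L1 hL1 h1] [L2 hL2 h2].
  exists ((fun y => L1 (Num.min v y)) \+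
          ((fun y => - h v + 0 * y) \+ (fun y => L2 (Num.max v y)))).
    apply: is_hinge_sumD; first exact: is_hinge_sum_minr.
    apply: is_hinge_sumD; first exact: is_hinge_sum_affine.
    exact: is_hinge_sum_maxr.
  move=> y /andP[uy yw] /=; have [vy|yv] := leP v y.
    by rewrite -h1 ?uv ?lexx// -h2 ?vy//; ring.
  by rewrite -h1 ?uy ?ltW// -h2 ?vw ?lexx//; ring.
move=> x; have [a [b [b0 /nbhs_ballP[e /= e0 he]]]] := hh x.
exists e => // u v u1 u2 v1 v2.
exists ((fun y => (h x - a * x) + a * y) \+ (fun y => b * Num.max 0 (y - x))).
  by apply: is_hinge_sumD; [exact: is_hinge_sum_affine|exact: is_hinge_sum_hinge].
move=> y /andP[y1 y2] /=; rewrite he; first by ring.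
by rewrite /ball/= ltr_norml; apply/andP; split; lra.
Qed.

(** Merges repeated breakpoints: the total weight, unlike a single one, is the slope jump at [x] and
    has a definite sign under convexity. *)
Definition hinge_weight s x : R := \sum_(p <- s | p.1 == x) p.2.

Lemma sum_hinge_weight s (phi : R -> R) :
  \sum_(p <- s) p.2 * phi p.1 =
  \sum_(x <- undup [seq p.1 | p <- s]) hinge_weight s x * phi x.
Proof.
under [RHS]eq_bigr do rewrite /hinge_weight mulr_suml big_mkcond/=.
rewrite exchange_big/= big_seq [RHS]big_seq; apply: eq_bigr => p ps.
have pU : p.1 \in undup [seq p.1 | p <- s].
  by rewrite mem_undup; apply/mapP; exists p.
rewrite (bigD1_seq p.1 pU (undup_uniq _))/= eqxx big1 ?addr0// => x.
by rewrite eq_sym => /negbTE ->.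
Qed.

Lemma corner_hinge_sum a b s x :
  exists a', corner (hinge_sum a b s) x a' (hinge_weight s x).
Proof.
elim: s => [|[p w] s [a' IH]].
  exists b; rewrite /hinge_weight big_nil; near=> y.
  by rewrite /hinge_sum !big_nil; ring.
have -> : hinge_sum a b ((p, w) :: s) =
          hinge_sum a b s \+ (fun y => w * Num.max 0 (y - p)).
  by apply/funext => y; rewrite /hinge_sum big_cons/=; ring.
have -> : hinge_weight ((p, w) :: s) x = (w *+ (p == x)) + hinge_weight s x.
  by rewrite /hinge_weight big_cons/=; case: eqP => _; rewrite ?add0r.
have [px|xp|->] := ltgtP p x.
- exists (a' + w).
  have : \forall y \near x, p < y by apply: lt_nbhsr.
  apply: filterS2 IH => y /= -> py; rewrite mulr0n.
  rewrite (max0_ge (_ : 0 <= y - p)); last lra.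
  by rewrite (max0_ge (_ : 0 <= x - p)); [ring|lra].
- exists a'.
  have : \forall y \near x, y < p by apply: lt_nbhsl.
  apply: filterS2 IH => y /= -> py; rewrite mulr0n.
  rewrite (max0_le (_ : y - p <= 0)); last lra.
  by rewrite (max0_le (_ : x - p <= 0)); [ring|lra].
- exists a'; apply: filterS IH => y /= ->.
  by rewrite subrr maxxx; ring.
Unshelve. all: by end_near. Qed.

Lemma omega_tinv_hinge_sum h a b s u v x :
  (forall y, u <= y <= v -> h y = hinge_sum a b s y) -> u < x < v ->
  omega (tinv h) x = - hinge_weight s x.
Proof.
move=> hL /andP[ux xv]; have [a' ca'] := corner_hinge_sum a b s x.
apply: (@omega_corner _ _ _ (- a')).
have nu : \forall y \near x, u < y by apply: lt_nbhsr.
have nv : \forall y \near x, y < v by apply: lt_nbhsl.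
apply: filterS3 ca' nu nv => y hy uy yv.
rewrite /tinv !hL ?hy; [by ring|lra|lra].
Qed.

(** The slope jump of [tinv h] at [x] is computed twice, from the local normal form and from the
    hinge sum; comparison identifies the weight with the nonnegative [b']. *)
Lemma hinge_weight_ge0 h a b s u v x : convex_pl h ->
  (forall y, u <= y <= v -> h y = hinge_sum a b s y) -> u < x < v ->
  0 <= hinge_weight s x.
Proof.
move=> hh hL uxv; have [a' [b' [b'0 hc]]] := hh x.
have : omega (tinv h) x = - b'.
  apply: (@omega_corner _ _ _ (- a')); apply: filterS hc => y hy.
  by rewrite /tinv hy; ring.
by rewrite (omega_tinv_hinge_sum hL uxv) => /oppr_inj ->.
Qed.

(** The three-slope inequality, cleared of denominators so that points may coincide. The affine part
    and the hinges outside []x, z[] contribute equally to both sides; the hinges inside have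
    nonnegative weight. *)
Lemma convex_pl_chord h x y z : convex_pl h -> x <= y -> y <= z ->
  (h y - h x) * (z - y) <= (h z - h y) * (y - x).
Proof.
move=> hh xy yz; have xz := le_trans xy yz.
have [L [a [b [s ->]]] hL] := convex_pl_hinge_sum hh xz.
rewrite !hL ?lexx ?xz ?xy ?yz// /hinge_sum.
rewrite !(@sum_hinge_weight s (fun p => Num.max 0 (_ - p))).
set A := \sum_(_ <- _) _; set B := \sum_(_ <- _) _; set C := \sum_(_ <- _) _.
suff : (A - B) * (z - y) <= (C - A) * (y - x) by move=> ?; lra.
rewrite -[A - B]sumrB -[C - A]sumrB !mulr_suml; apply: ler_sum => p _.
rewrite -!mulrBr -!mulrA.
have [px|xp] := leP p x.
  by rewrite !max0_ge; lra.
have [zp|pz] := leP z p.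
  by rewrite !max0_le; lra.
have wp := hinge_weight_ge0 hh hL (introT andP (conj xp pz)).
apply: ler_wpM2l => //.
rewrite [in X in _ <= (X - _) * _]max0_ge; last lra.
rewrite [in X in (_ - X) * _ <= _]max0_le; last lra.
have [py|yp] := leP p y.
  rewrite max0_ge; nra.
by rewrite max0_le; nra.
Qed.

Lemma pole_count_tinv h a b s r t : convex_pl h ->
  (forall y, - r <= y <= r -> h y = hinge_sum a b s y) -> 0 <= t <= r ->
  pole_count t (tinv h) =
  \sum_(p <- s) p.2 * \1_(`]`|p.1|, r]%classic) t.
Proof.
move=> hh hL /andP[t0 tr]; rewrite /pole_count.
set X := [seq x <- undup [seq p.1 | p <- s] | `|x| < t].
have inr x : - t < x < t -> - r < x < r by move=> /andP[? ?]; apply/andP; split; lra.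
(* The poles of [tinv h] in []-t, t[] are widened to all distinct breakpoints there; the extra
   points have weight zero. *)
rewrite (fsbig_fwiden X).
- rewrite big_filter (@sum_hinge_weight s (fun p => \1_(`]`|p|, r]%classic) t)).
  rewrite big_mkcond; apply: eq_bigr => x _; rewrite indicE mem_setE in_itv/= tr andbT.
  case: ifP => xt; rewrite ?mulr0// mulr1 (omega_tinv_hinge_sum hL) ?opprK//.
  by apply: inr; rewrite -ltr_norml.
- move=> x /= [xt]; rewrite /is_pole (omega_tinv_hinge_sum hL); last exact: inr.
  rewrite mem_filter mem_undup ltr_norml xt/=.
  apply: contraPT => xs; rewrite /hinge_weight big_seq_cond big1 ?oppr0 ?ltxx//.
  by move=> p /andP[ps /eqP px]; case/mapP: xs; exists p.
- by rewrite filter_uniq// undup_uniq.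
- move=> x [/=]; rewrite mem_filter ltr_norml => /andP[xt _] /not_andP[//|].
  rewrite /is_pole (omega_tinv_hinge_sum hL); last exact: inr.
  have := hinge_weight_ge0 hh hL (inr _ xt).
  rewrite le_eqVlt => /predU1P[<- _|w0 /negP]; first by rewrite !oppr0.
  by rewrite oppr_lt0 w0.
Qed.

Lemma Rintegral_sum_indic s r : 0 <= r ->
  \int[lebesgue_measure]_(t in `[0, r])
     (\sum_(p <- s) p.2 * \1_(`]`|p.1|, r]%classic) t) =
  \sum_(p <- s) p.2 * Num.max 0 (r - `|p.1|).
Proof.
move=> r0; pose mu := @lebesgue_measure R.
have mr : measurable (`[0, r]%classic : set (measurableTypeR R)).
  exact: measurable_itv.
have int1 (p c : R) : mu.-integrable `[0, r]
    (EFin \o (fun t => c * \1_(`]`|p|, r]%classic) t)).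
  have -> : (EFin \o (fun t => c * \1_(`]`|p|, r]%classic) t)) =
    (fun t => c%:E * (\1_(`]`|p|, r]%classic) t)%:E)%E.
    by apply/funext => t /=; rewrite EFinM.
  apply: integrableZl => //.
  apply: (@integrableS _ _ _ mu setT) => //.
  exact: (integrable_indic_itv `|p| r false false).
have intS s' : mu.-integrable `[0, r]
    (EFin \o (fun t => \sum_(p <- s') p.2 * \1_(`]`|p.1|, r]%classic) t)).
  have -> : (EFin \o (fun t => \sum_(p <- s') p.2 * \1_(`]`|p.1|, r]%classic) t)) =
    (fun t => \sum_(p <- s') (p.2 * \1_(`]`|p.1|, r]%classic) t)%:E)%E.
    by apply/funext => t /=; rewrite -sumEFin.
  by apply: integrable_sum => // p _; exact: int1.
elim: s => [|[p c] s IH].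
  under eq_Rintegral do rewrite big_nil.
  by rewrite Rintegral_cst// mul0r big_nil.
under eq_Rintegral do rewrite big_cons.
rewrite RintegralD//.
rewrite IH big_cons/=; congr (_ + _).
rewrite RintegralZl//; last first.
  by apply: eq_integrable (int1 p 1%R) => // t _ /=; rewrite mul1r.
congr (_ * _); rewrite /Rintegral integral_indic//.
have -> : `]`|p|, r]%classic `&` `[0, r]%classic = `]`|p|, r]%classic.
  apply/setIidl => t /=; rewrite !in_itv/= => /andP[pt ->]; rewrite andbT.
  by have := normr_ge0 p; lra.

rewrite [X in fine X]lebesgue_measure_itv/= lte_fin.
case: ltP => pr; first by rewrite max0_ge//; lra.
by rewrite max0_le//; lra.
Qed.

(** Jensen's formula. Both sides are linear in the hinges of [h], and the affine part has symmetric
    mean zero, so it is enough to treat a single hinge. *)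
Lemma Ncount_tinv h r : convex_pl h -> 0 <= r ->
  Ncount r (tinv h) = 2^-1 * (h r + h (- r)) - h 0.
Proof.
move=> hh r0; have rr : - r <= r by lra.
have [L [a [b [s ->]]] hL] := convex_pl_hinge_sum hh rr.
rewrite /Ncount; under eq_Rintegral => t.
  rewrite inE/= in_itv/= => t0; rewrite (pole_count_tinv hh hL t0); over.
rewrite Rintegral_sum_indic// !hL; try lra.
rewrite /hinge_sum; set A := \sum_(_ <- _) _; set B := \sum_(_ <- _) _.
set C := \sum_(_ <- _) _; set D := \sum_(_ <- _) _.
(* For one hinge at [p] this is [max 0 (r - |p|) = max 0 (r - p) + max 0 (- r - p) - 2 * max 0 (-
   p)]. *)
suff -> : A = (B + C) - 2 * D by field.
rewrite /A /B /C /D mulr_sumr -big_split -sumrB; apply: eq_bigr => p _ /=.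
rewrite mulrCA -mulrDr -mulrBr; congr (_ * _).
case: p => p c /=; case: (leP 0 p) => p0.
  rewrite ger0_norm// [in X in _ - 2 * X]max0_le; last lra.
  by rewrite [in X in _ + X - _]max0_le; lra.
rewrite ltr0_norm// [in X in _ - 2 * X]max0_ge; last lra.
rewrite [in X in X + _ - _]max0_ge; last lra.
have [pr|pr] := leP 0 (r + p).
  by rewrite max0_ge ?max0_le; lra.
by rewrite max0_le ?max0_ge; lra.
Qed.

End Jensen.

(** * Increments of slowly growing functions *)

Section SmallIncrements.
Context {R : realType}.

(* Koopman-von Neumann; taking [K k] to mean that [a k] exceeds the square root
   of the largest later mean makes a diagonal argument unnecessary. *)
Lemma density_zero_exceptional_indices (a : nat -> R) :
  (forall k, 0 <= a k) ->
  (forall e : R, 0 < e -> exists N, forall n, (N <= n)%N ->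
     \sum_(k < n) a k <= e * n%:R) ->
  exists K : pred nat,
    (forall e : R, 0 < e -> exists N, forall k, (N <= k)%N -> ~~ K k -> a k <= e) /\
    (forall e : R, 0 < e -> exists N, forall n, (N <= n)%N ->
       (count K (iota 0 n))%:R <= e * n%:R).
Proof.
move=> a0 ha.
(* The mean of the first [m] terms, with 1 added to their sum: this keeps the supremum [eta n] of
   the later means strictly positive, so that its square root can be cancelled. *)
pose u m : R := (1 + \sum_(k < m) a k) / m%:R.
pose U n := [set u m | m in [set m | (n < m)%N]].
have ub (e : R) : 0 < e -> exists N, forall m, (N < m)%N -> u m <= e.
  move=> e0; have e20 : 0 < e / 2 by lra.
  have [N hN] := ha _ e20.
  exists (maxn N (Num.truncn (2 / e)).+1) => m; rewrite gtn_max => /andP[Nm em].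
  have m0 : 0 < m%:R :> R by rewrite ltr0n; apply: leq_trans em.
  rewrite /u ler_pdivrMr//; apply: le_trans (_ : 1 + e / 2 * m%:R <= _).
    by rewrite lerD2l hN// ltnW.
  have : 2 / e < m%:R.
    have /andP[_] := truncn_itv (ltW (divr_gt0 (ltr0Sn _ 1) e0)).
    by move=> /lt_trans; apply; rewrite ltr_nat.
  by rewrite ltr_pdivrMr//; lra.
have U0 n : U n !=set0 by exists (u n.+1), n.+1 => /=.
have Usup n : has_sup (U n).
  split=> //; have [N hN] := ub 1 ltr01.
  exists (Num.max 1 (1 + \sum_(k < N) a k)) => _ [m /= nm <-].
  have [Nm|mN] := ltnP N m; first by rewrite le_max hN.
  rewrite le_max; apply/orP; right.
  have m1 : 1 <= m%:R :> R by rewrite ler1n; apply: leq_ltn_trans nm.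
  have s0 : 0 <= \sum_(k < m) a k by apply: sumr_ge0.
  apply: le_trans (_ : 1 + \sum_(k < m) a k <= _).
    by rewrite /u ler_pdivrMr; nra.
  rewrite lerD2l -(subnKC mN) big_split_ord/= lerDl.
  exact: sumr_ge0.
pose eta n := sup (U n).
have u_eta n m : (n < m)%N -> u m <= eta n.
  by move=> nm; apply: ub_le_sup; [case: (Usup n)|exists m].
have eta_small (e : R) : 0 < e -> exists N, forall n, (N <= n)%N -> eta n <= e.
  move=> /ub[N hN]; exists N => n Nn; apply: ge_sup => // _ [m /= nm <-].
  by apply: hN; exact: leq_ltn_trans nm.
have eta_ninc n m : (n <= m)%N -> eta m <= eta n.
  move=> nm; apply: ge_sup => // _ [k /= mk <-].
  by apply: u_eta; exact: leq_ltn_trans mk.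
have eta0 n : 0 < eta n.
  apply: lt_le_trans (u_eta n n.+1 _) => //.
  rewrite /u divr_gt0 ?ltr0n// ltr_pwDl ?ltr01//.
  exact: sumr_ge0.
exists (fun k => Num.sqrt (eta k) < a k); split=> [e e0|e e0].
  have [N hN] := eta_small _ (exprn_gt0 2 e0).
  exists N => k Nk; rewrite -leNgt => /le_trans; apply.
  by rewrite -[leRHS](gtr0_norm e0) -sqrtr_sqr ler_wsqrtr// hN.
have [N hN] := eta_small _ (exprn_gt0 2 e0).
exists N.+1 => -[//|n] Nn.
set t := Num.sqrt (eta n).
have t0 : 0 < t by rewrite sqrtr_gt0.
have te : t <= e by rewrite -[leRHS](gtr0_norm e0) -sqrtr_sqr ler_wsqrtr// hN.
have htt : t * t = eta n by rewrite -expr2 sqr_sqrtr// ltW.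
(* Markov's inequality: each counted [k <= n] has [a k > sqrt (eta k) >= t], while the first [n + 1]
   terms sum to at most [eta n * (n + 1)], since [eta n] takes in the mean of index [n + 1]. *)
suff : (count (fun k => Num.sqrt (eta k) < a k) (iota 0 n.+1))%:R * t
    <= t * t * n.+1%:R.
  rewrite (mulrC t t) -mulrA mulrC ler_pM2l// => /le_trans; apply.
  by rewrite ler_wpM2r.
rewrite htt; apply: le_trans (_ : 1 + \sum_(k < n.+1) a k <= _); last first.
  by rewrite -ler_pdivrMr ?ltr0n//; exact: u_eta.
apply: le_trans (_ : \sum_(k < n.+1) a k <= _); last by rewrite lerDr.
rewrite -(big_mkord xpredT a) /index_iota subn0.
rewrite -sum1_count natr_sum mulr_suml big_mkcond.
rewrite big_seq [leRHS]big_seq; apply: ler_sum => k.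
rewrite mem_iota add0n /= => kn.
case: ifP => // hk; rewrite mul1r; apply: le_trans (ltW hk).
by rewrite ler_wsqrtr// eta_ninc.
Qed.

Lemma limf_esup_pinfty0 (phi : R -> R) :
  (forall e : R, 0 < e -> exists r0, forall r, r0 < r -> 0 <= phi r <= e) ->
  limf_esup (fun r => (phi r)%:E) (pinfty_nbhs R) = 0%E.
Proof.
move=> hphi; apply/eqP; rewrite eq_le; apply/andP; split.
  apply/lee_addgt0Pr => e e0; rewrite add0e.
  have [r0 hr0] := hphi _ e0.
  apply: ge_ereal_inf.
  exists (ereal_sup ((fun r => (phi r)%:E) @` [set r | r0 < r])).
    exists [set r | r0 < r] => //.
    by exists r0; split=> //; exact: num_real.
  by apply: ge_ereal_sup => _ [r /= /hr0/andP[_ pe] <-]; rewrite lee_fin.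
apply: le_ereal_inf_tmp => _ [V [M [_ MV]] <-].
have [r0 hr0] := hphi _ ltr01.
pose r := Num.max M r0 + 1.
have Mr : M < r by rewrite (le_lt_trans (_ : M <= Num.max M r0))// ?le_max ?lexx// ltrDl.
have r0r : r0 < r.
  by rewrite (le_lt_trans (_ : r0 <= Num.max M r0))// ?le_max ?lexx ?orbT// ltrDl.
apply: le_ereal_sup_tmp; exists (phi r)%:E; first by exists r => //; exact: MV.
by rewrite lee_fin; have /andP[] := hr0 _ r0r.
Qed.

Lemma lebesgue_measure_bigsetU_itv (s : R) (l : seq nat) : 0 < s ->
  (lebesgue_measure (\big[setU/set0]_(k <- l)
     `[(s * k%:R)%R, (s * k.+1%:R)%R[%classic) <= (s * (size l)%:R)%:E)%E.
Proof.
move=> s0; elim: l => [|k l IH]; first by rewrite big_nil measure0 mulr0.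
have mU : measurable (\big[setU/set0]_(k <- l)
   `[(s * k%:R)%R, (s * k.+1%:R)%R[%classic : set (measurableTypeR R)).
  by apply: bigsetU_measurable => i _; exact: measurable_itv.
rewrite big_cons; apply: le_trans.
  apply: measureU2 => //; exact: measurable_itv.
rewrite /= -[(size l).+1%:R]natr1 mulrDr mulr1 addrC EFinD; apply: leeD => //.
rewrite lebesgue_measure_itv/= lte_fin.
by case: ifP => _; rewrite lee_fin; [rewrite -natr1; lra|exact: ltW].
Qed.

Lemma zero_upper_density_bigcup_itv (s : R) (K : pred nat) : 0 < s ->
  (forall e : R, 0 < e -> exists N, forall n, (N <= n)%N ->
     (count K (iota 0 n))%:R <= e * n%:R) ->
  zero_upper_density
    (\bigcup_(k in [set k | K k]) `[(s * k%:R)%R, (s * k.+1%:R)%R[%classic).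
Proof.
move=> s0 hK; set E := \bigcup_(_ in _) _.
have mE : measurable (E : set (measurableTypeR R)).
  by apply: bigcup_measurable => k _; exact: measurable_itv.
have mEr (r : R) : measurable (E `&` `[1, r] : set (measurableTypeR R)).
  by apply: measurableI => //; exact: measurable_itv.
have muE (r : R) : 0 <= r -> (lebesgue_measure (E `&` `[1%R, r]) <=
   (s * (count K (iota 0 (Num.truncn (r / s)).+1))%:R)%:E)%E.
  move=> r0; set n := (Num.truncn _).+1; rewrite -size_filter.
  apply: le_trans (lebesgue_measure_bigsetU_itv _ s0).
  apply: le_measure; rewrite ?inE//.
    by apply: bigsetU_measurable => i _; exact: measurable_itv.
  move=> x [[k /= Kk]]; rewrite !in_itv/= => /andP[kx xk] /andP[_ xr].
  rewrite -bigcup_seq; suff kn : k \in [seq i <- iota 0 n | K i].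
    by exists k; rewrite ?/= ?in_itv/= ?kx.
  rewrite mem_filter Kk mem_iota/= add0n /n.
  have /andP[_ rn] := truncn_itv (divr_ge0 r0 (ltW s0)).
  rewrite -(ltr_nat R); apply: le_lt_trans rn.
  by rewrite ler_pdivlMr// mulrC; exact: le_trans xr.
split=> //.
have -> : (fun r : R => (r^-1)%:E *
    \int[lebesgue_measure]_(t in E `&` `[1%R, r]) 1)%E =
  (fun r => (r^-1 * fine (lebesgue_measure (E `&` `[1%R, r])))%:E).
  apply/funext => r; rewrite integral_cst// mul1e EFinM fineK//.
  rewrite ge0_fin_numE//.
  apply: le_lt_trans (_ : (lebesgue_measure `[1%R, r]%classic < +oo)%E).
    by apply: le_measure; rewrite ?inE//; exact: measurable_itv.
  by rewrite lebesgue_measure_itv/=; case: ifP => _; rewrite ?ltry.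
apply: limf_esup_pinfty0 => e e0.
have e20 : 0 < e / 2 by lra.
have [N hN] := hK _ e20.
(* At most [truncn (r / s) + 1] cells meet [[1, r]]. The bound [s < r] absorbs the extra cell, at
   the price of [e / 2], and [s * N < r] makes this number at least [N]. *)
exists (Num.max s (s * N%:R)) => r; rewrite gt_max => /andP[sr Nr].
have r0 : 0 < r by lra.
apply/andP; split.
  by rewrite mulr_ge0 ?fine_ge0// invr_ge0 ltW.
rewrite ler_pdivrMl//.
have /andP[nr rn] := truncn_itv (divr_ge0 (ltW r0) (ltW s0)).
rewrite ler_pdivlMr// in nr.
have mle := muE _ (ltW r0).
have mfin : lebesgue_measure (E `&` `[1, r]) \is a fin_num.
  by rewrite ge0_fin_numE// (le_lt_trans mle)// ltry.
move: mle; rewrite -(fineK mfin) lee_fin => /le_trans; apply.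
have Nn : (N <= (Num.truncn (r / s)).+1)%N.
  rewrite -(ler_nat R); apply: le_trans (ltW rn).
  by rewrite ler_pdivlMr// mulrC ltW.
apply: le_trans (_ : s * (e / 2 * (Num.truncn (r / s)).+1%:R) <= _).
  by rewrite ler_pM2l// hN.
rewrite -[(Num.truncn (r / s)).+1%:R]natr1; set t := (Num.truncn _)%:R in nr *.
have : e * (t * s + s) <= e * (r + r) by rewrite ler_wpM2l; lra.
lra.
Qed.

(** The increments of [ln W] over two consecutive cells of length [s] telescope, so
    [ln (W r) = o(r)] makes their means tend to zero; by the Koopman-von Neumann argument they are
    small outside a set of cells of density zero. *)
Lemma small_increments (W : R -> R) (s : R) : 0 < s ->
  (forall x y, 0 <= x -> x <= y -> W x <= W y) ->
  (forall x, 0 <= x -> 1 <= W x) ->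
  (forall e : R, 0 < e -> exists r0, forall r, r0 < r -> ln (W r) <= e * r) ->
  exists2 E : set R, zero_upper_density E &
    forall e : R, 0 < e -> exists r0, forall r, r0 < r -> ~ E r ->
      W (r + s) <= (1 + e) * W r.
Proof.
move=> s0 Wnd W1 Wln.
pose L k := ln (W (s * k%:R)).
have sk0 k : 0 <= s * k%:R by rewrite mulr_ge0// ltW.
have lnW x y : 0 <= x -> x <= y -> ln (W x) <= ln (W y).
  move=> x0 xy; rewrite ler_ln ?posrE ?Wnd//.
    exact: lt_le_trans ltr01 (W1 _ _).
  exact: lt_le_trans ltr01 (W1 _ (le_trans x0 xy)).
have L0 k : 0 <= L k by rewrite ln_ge0// W1.
have Lnd k l : (k <= l)%N -> L k <= L l.
  by move=> kl; apply: lnW => //; rewrite ler_wpM2l ?ler_nat// ltW.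
(* Two cells, because [r] in cell [k] puts [r + s] in cell [k + 1], which ends at [s * (k + 2)]. *)
pose a k := L k.+2 - L k.
have a0 k : 0 <= a k by rewrite subr_ge0 Lnd//; exact: leq_trans (leqnSn _).
have suma n : \sum_(k < n) a k = L n.+1 + L n - L 1 - L 0.
  elim: n => [|n IH]; first by rewrite big_ord0; ring.
  by rewrite big_ord_recr/= IH /a; ring.
have [e e0|K [Ka Kd]] := density_zero_exceptional_indices a0.
  (* For [n + 1] terms the telescoped sum keeps two positive logarithms, at [s * (n + 1)] and
     [s * (n + 2)], and [(n + 1) + (n + 2) <= 4 * (n + 1)]. *)
  have e40 : 0 < e / (4 * s) by rewrite divr_gt0// mulr_gt0.
  have [r0 hr0] := Wln _ e40.
  exists (Num.truncn (`|r0| / s)).+1 => -[//|n] Nn.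
  have /andP[_ rn] := truncn_itv (divr_ge0 (normr_ge0 r0) (ltW s0)).
  have : `|r0| < s * n.+1%:R.
    rewrite mulrC -ltr_pdivrMr//; apply: lt_le_trans rn _.
    by rewrite ler_nat.
  move=> /(le_lt_trans (ler_norm _)) rn1.
  have rn2 : r0 < s * n.+2%:R.
    by apply: lt_le_trans rn1 _; rewrite ler_pM2l// ler_nat.
  have L2 : L n.+2 <= e / (4 * s) * (s * n.+2%:R) by exact: hr0.
  have L1 : L n.+1 <= e / (4 * s) * (s * n.+1%:R) by exact: hr0.
  have es k : e / (4 * s) * (s * k) = e * k / 4 by field; lra.
  have n0 : 0 <= n%:R :> R by [].
  rewrite suma; rewrite !es in L1 L2; move: (L0 0%N) (L0 1%N) => L00 L01.
  rewrite -[n.+2%:R]natr1 -[n.+1%:R]natr1 in L1 L2 *; nra.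
exists (\bigcup_(k in [set k | K k]) `[(s * k%:R)%R, (s * k.+1%:R)%R[%classic).
  exact: zero_upper_density_bigcup_itv.
move=> e e0; have le0 : 0 < ln (1 + e) by rewrite ln_gt0//; lra.
have [N hN] := Ka _ le0.
exists (s * N%:R) => r Nr nEr.
have r0 : 0 <= r by apply: le_trans (ltW Nr).
have /andP[nr rn] := truncn_itv (divr_ge0 r0 (ltW s0)).
set k := Num.truncn (r / s) in nr rn.
rewrite ler_pdivlMr// mulrC in nr.
rewrite ltr_pdivrMr// mulrC in rn.
have nKk : ~~ K k.
  by apply/negP => Kk; apply: nEr; exists k => //=; rewrite in_itv/= nr rn.
have Nk : (N <= k)%N.
  by rewrite -ltnS -(ltr_nat R) -(ltr_pM2l s0); exact: lt_trans rn.
have ak := hN _ Nk nKk.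
have Wr : 0 < W r by apply: lt_le_trans ltr01 (W1 _ _).
have Wrs : 0 < W (r + s) by apply: lt_le_trans ltr01 (W1 _ _); lra.
rewrite -ler_ln ?posrE//; last by rewrite mulr_gt0//; lra.
rewrite lnM ?posrE//; last lra.
have h1 : ln (W (r + s)) <= L k.+2.
  by apply: lnW; first lra; rewrite -[k.+2%:R]natr1 mulrDr mulr1; lra.
have h2 : L k <= ln (W r) by apply: lnW.
by move: ak; rewrite /a; lra.
Qed.

End SmallIncrements.

(** * Symmetric means and tropical curves *)

Section SymmetricMean.
Context {R : realType}.
Implicit Types (h : R -> R) (r s t x y : R).

(** By [Ncount_tinv] this counts the zeros of a convex piecewise linear [h]; for [tnorm f] it is
    [Tchar f]. *)
Definition symm_mean h r : R := 2^-1 * (h r + h (- r)) - h 0.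

Lemma convex_pl_opp h : convex_pl h -> convex_pl (fun y => h (- y)).
Proof.
move=> hh x; have [a [b [b0 ch]]] := hh (- x).
exists (- (a + b)), b; split=> //.
move: ch => /nbhs_ballP[e /= e0 he]; apply/nbhs_ballP; exists e => // y.
rewrite /ball/= => xy; rewrite he; last first.
  rewrite /ball/=; suff -> : - x - - y = - (x - y) by rewrite normrN.
  by ring.
have [yx|yx] := leP x y.
  rewrite [in LHS]max0_le; last lra.
  by rewrite max0_ge; [ring|lra].
rewrite [in LHS]max0_ge; last lra.
by rewrite max0_le; [ring|lra].
Qed.

Lemma convex_pl_incr h x y t : convex_pl h -> x <= y -> 0 <= t ->
  h (x + t) - h x <= h (y + t) - h y.
Proof.
move=> hh xy; rewrite le_eqVlt => /predU1P[<-|t0]; first by rewrite !addr0 !subrr.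
have c1 : (h (x + t) - h x) * (y + t - (x + t)) <=
          (h (y + t) - h (x + t)) * (x + t - x) by apply: convex_pl_chord => //; lra.
have c2 : (h y - h x) * (y + t - y) <= (h (y + t) - h y) * (y - x).
  by apply: convex_pl_chord => //; lra.
have d0 : 0 < y + t - x by lra.
rewrite -(ler_pM2r d0); nra.
Qed.

(** By convexity the rise over [[x, y]] is at least the rise over [[- y, - x]]. *)
Lemma symm_mean_nondecreasing h x y : convex_pl h -> 0 <= x -> x <= y ->
  symm_mean h x <= symm_mean h y.
Proof.
move=> hh x0 xy; rewrite /symm_mean.
have := @convex_pl_incr h (- y) x (y - x) hh.
have -> : - y + (y - x) = - x by ring.
have -> : x + (y - x) = y by ring.
by move=> H; have := H ltac:(lra) ltac:(lra); lra.
Qed.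

Lemma symm_mean_ge0 h r : convex_pl h -> 0 <= r -> 0 <= symm_mean h r.
Proof.
move=> hh r0; apply: le_trans (symm_mean_nondecreasing hh (lexx 0) r0).
by rewrite /symm_mean oppr0; lra.
Qed.

Lemma convex_pl_star h s r : convex_pl h -> 0 <= s -> s <= r ->
  (h s - h 0) * r <= (h r - h 0) * s.
Proof.
by move=> hh s0 sr; have := convex_pl_chord hh s0 sr; lra.
Qed.

(** Chord slopes from 0 are nondecreasing, for [h] and for its reflection. This is the source of the
    linear growth of [Tchar f]. *)
Lemma symm_mean_star h s r : convex_pl h -> 0 <= s -> s <= r ->
  symm_mean h s * r <= symm_mean h r * s.
Proof.
move=> hh s0 sr; have := convex_pl_star hh s0 sr.
have := convex_pl_star (convex_pl_opp hh) s0 sr.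
by rewrite oppr0 /symm_mean; lra.
Qed.

(** The means, being nonnegative too, vanish; then [h - h 0] is odd, and the star inequalities for
    [h] and its reflection combine to equalities. *)
Lemma symm_mean_eq0_affine h x : convex_pl h ->
  (forall r, 0 <= r -> symm_mean h r <= 0) -> h x = h 0 + (h 1 - h 0) * x.
Proof.
move=> hh h0.
have heq r : 0 <= r -> h (- r) = 2 * h 0 - h r.
  move=> r0; have := h0 _ r0; have := symm_mean_ge0 hh r0.
  by rewrite /symm_mean; lra.
have starE s r : 0 <= s -> s <= r -> (h s - h 0) * r = (h r - h 0) * s.
  move=> s0 sr; have r0 := le_trans s0 sr; have := convex_pl_star hh s0 sr.
  have := convex_pl_star (convex_pl_opp hh) s0 sr.
  by rewrite oppr0 !heq//; lra.
have pos r : 0 <= r -> h r = h 0 + (h 1 - h 0) * r.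
  move=> r0; have [r1|r1] := leP r 1.
    by have := starE _ _ r0 r1; lra.
  by have := starE _ _ ler01 (ltW r1); lra.
have [x0|x0] := leP 0 x; first exact: pos.
rewrite -[in LHS](opprK x) heq; last lra.
by rewrite (pos (- x)); [ring|lra].
Qed.

(** The slope between [r] and [r + y] is controlled by those over [[r - s, r]] and [[r, r + s]],
    both at least that over [[0, s]]. The multiple of [|h s - h 0|] covers negative slopes. *)
Lemma convex_pl_increment_right h s r y : convex_pl h -> 0 < s -> s <= r ->
  `|y| <= s ->
  `|h (r + y) - h r| <= h (r + s) - h r + 3 * `|h s - h 0|.
Proof.
move=> hh s0 sr; rewrite ler_norml => /andP[ys1 ys2].
have r0 : 0 <= r by lra.
have D1 : h s - h 0 <= h (r + s) - h r.
  by have := @convex_pl_incr h 0 r s hh; rewrite add0r; apply; lra.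
have D2 : h s - h 0 <= h r - h (r - s).
  have := @convex_pl_incr h 0 (r - s) s hh; rewrite add0r subrK.
  by apply; lra.
have [n1 n2] : - `|h s - h 0| <= h s - h 0 /\ h s - h 0 <= `|h s - h 0|.
  by split; [rewrite lerNl -normrN ler_norm|exact: ler_norm].
have n0 := normr_ge0 (h s - h 0).
set c := h s - h 0 in D1 D2 n1 n2 n0 *.
set D := h (r + s) - h r in D1 *.
set D' := h r - h (r - s) in D2 *.
have [y0|y0] := leP 0 y.
  have up : (h (r + y) - h r) * s <= D * y.
    have := @convex_pl_chord _ h r (r + y) (r + s) hh ltac:(lra) ltac:(lra).
    by rewrite /D; lra.
  have lo : D' * y <= (h (r + y) - h r) * s.
    have := @convex_pl_chord _ h (r - s) r (r + y) hh ltac:(lra) ltac:(lra).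
    by rewrite /D'; lra.
  rewrite ler_norml; apply/andP; split; rewrite -(ler_pM2r s0); nra.
have up : (h r - h (r + y)) * s <= D * - y.
  have := @convex_pl_chord _ h (r + y) r (r + s) hh ltac:(lra) ltac:(lra).
  by rewrite /D; lra.
have lo : D' * - y <= (h r - h (r + y)) * s.
  have := @convex_pl_chord _ h (r - s) (r + y) r hh ltac:(lra) ltac:(lra).
  by rewrite /D'; lra.
rewrite ler_norml; apply/andP; split; rewrite -(ler_pM2r s0); nra.
Qed.

Lemma convex_pl_increment h s : convex_pl h -> 0 < s ->
  exists K, forall r y, s <= r -> `|y| <= s ->
    `|h (r + y) - h r| <=
      2 * (symm_mean h (r + s) - symm_mean h r) + K /\
    `|h (- r + y) - h (- r)| <=
      2 * (symm_mean h (r + s) - symm_mean h r) + K.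
Proof.
move=> hh s0; have hh' := convex_pl_opp hh.
(* Three copies come from the one-sided estimate; the fourth bounds from below the rise on the
   opposite side, which is added to form twice the rise of the mean. *)
exists (4 * (`|h s - h 0| + `|h (- s) - h 0|)) => r y sr ys.
have r0 : 0 <= r by lra.
have D1 : h s - h 0 <= h (r + s) - h r.
  by have := @convex_pl_incr h 0 r s hh; rewrite add0r; apply; lra.
have D2 : h (- s) - h 0 <= h (- (r + s)) - h (- r).
  by have := @convex_pl_incr _ 0 r s hh'; rewrite add0r oppr0; apply; lra.
have n1 : - `|h s - h 0| <= h s - h 0 by rewrite lerNl -normrN ler_norm.
have n2 : - `|h (- s) - h 0| <= h (- s) - h 0 by rewrite lerNl -normrN ler_norm.
have p1 := normr_ge0 (h s - h 0); have p2 := normr_ge0 (h (- s) - h 0).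
have e1 := convex_pl_increment_right hh s0 sr ys.
have ys' : `|- y| <= s by rewrite normrN.
have e2 := convex_pl_increment_right hh' s0 sr ys'.
rewrite oppr0 opprD opprK in e2.
by rewrite /symm_mean; split; lra.
Qed.

End SymmetricMean.

(** * Compositions with tropical polynomials, and positivity of the characteristic function *)

Section Curves.
Context {R : realType} {n : nat}.
Implicit Types (f : 'I_n.+1 -> R -> R) (r x : R).

Lemma Tchar_symm_mean f : Tchar f = symm_mean (tnorm f).
Proof. by []. Qed.

Lemma convex_pl_tnorm f : (forall k, convex_pl (f k)) -> convex_pl (tnorm f).
Proof. by move=> hf; exact: convex_pl_bigmax. Qed.

Lemma le_tnorm f k x : f k x <= tnorm f x.
Proof. by rewrite /tnorm; apply: le_bigmax. Qed.

(** The exponent of the pure tropical power of degree [d] of the coordinate [k]; along the curve the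
    maximum of these powers is [d * tnorm f]. *)
Definition expo_pure d (k : 'I_n.+1) : {ffun 'I_n.+1 -> 'I_d.+1} :=
  [ffun i => if i == k then ord_max else ord0].

Lemma expo_pure_subproof d k :
  (\sum_(i < n.+1) (expo_pure d k i : nat) == d)%N.
Proof.
rewrite (bigD1 k)//= ffunE eqxx big1 ?addn0// => i /negbTE ik.
by rewrite ffunE ik.
Qed.

Definition pure d k : expo n d :=
  exist (fun I : {ffun 'I_n.+1 -> 'I_d.+1} =>
    is_true (\sum_(i < n.+1) (I i : nat) == d)%N) _ (expo_pure_subproof d k).

Lemma tmonomial_curve d (I : expo n d) f x :
  tmonomial I (curve_point f x) = (\sum_(k < n.+1) f k x *+ val I k)%:E.
Proof.
by rewrite /tmonomial -sumEFin; apply: eq_bigr => k _; rewrite EFin_natmul.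
Qed.

Lemma tmonomial_pure d k f x :
  tmonomial (pure d k) (curve_point f x) = (d%:R * f k x)%:E.
Proof.
rewrite tmonomial_curve (bigD1 k)//= ffunE eqxx big1 ?addr0.
  by rewrite mulr_natl.
by move=> i /negbTE ik; rewrite ffunE ik mulr0n.
Qed.

Lemma convex_pl_monomial d (I : expo n d) f :
  (forall k, convex_pl (f k)) ->
  convex_pl (fun x => \sum_(k < n.+1) f k x *+ val I k).
Proof.
move=> hf; apply: (@convex_pl_sum _ _ _ (fun k x => f k x *+ val I k)) => k.
have -> : (fun x => f k x *+ val I k) = (fun x => (val I k)%:R * f k x).
  by apply/funext => x; rewrite mulr_natl.
exact: convex_plZ.
Qed.

Lemma monomial_le_tnorm d (I : expo n d) f x :
  \sum_(k < n.+1) f k x *+ val I k <= d%:R * tnorm f x.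
Proof.
case: I => I /= /eqP Id; rewrite mulr_natl -[in leRHS]Id -sumrMnr.
by apply: ler_sum => k _; rewrite lerMn2r le_tnorm orbT.
Qed.

Lemma teval_curve d (P : tpoly R n d) f x :
  teval P (curve_point f x) = (tcomp P f x)%:E.
Proof.
rewrite /tcomp fineK// fin_numE; apply/andP; split.
  have [J PJ] := coef_nonzero P.
  apply/eqP => Poo.
  have : (coef P J + tmonomial J (curve_point f x) <= -oo)%E.
    by rewrite -Poo; exact: le_bigmax.
  rewrite tmonomial_curve; move: PJ (coef_Rmax P J).
  by case: (coef P J).
rewrite /teval; elim/big_ind: _ => // [u v|I _].
  by rewrite /maxe; case: ifP.
rewrite tmonomial_curve; have := coef_Rmax P I.
by case: (coef P I).
Qed.

Lemma convex_pl_tcomp d (P : tpoly R n d) f :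
  (forall k, convex_pl (f k)) -> convex_pl (tcomp P f).
Proof.
move=> hf.
(* A coefficient [-oo] removes its term, and while no term survives the maximum is [-oo], which no
   real function represents; hence the alternative in the induction. *)
suff H (l : seq (expo n d)) :
  (forall x, \big[maxe/-oo%E]_(I <- l)
      (coef P I + tmonomial I (curve_point f x))%E = -oo%E) \/
  (exists2 g, convex_pl g & forall x, \big[maxe/-oo%E]_(I <- l)
      (coef P I + tmonomial I (curve_point f x))%E = (g x)%:E).
  have [Hoo|[g hg gE]] := H (index_enum (expo n d)).
    have := teval_curve P f 0; rewrite /teval.
    by rewrite Hoo.
  suff -> : tcomp P f = g by [].
  by apply/funext => x; rewrite /tcomp /teval gE.
elim: l => [|I l IH]; first by left => x; rewrite big_nil.
have := coef_Rmax P I; case cI : (coef P I) => [c| |]// _.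
  right; pose m x := c + \sum_(k < n.+1) f k x *+ val I k.
  have hm : convex_pl m.
    have hc := convex_plD (convex_pl_affine 0 c) (convex_pl_monomial I hf).
    suff -> : m = (fun y => 0 * y + c) \+
      (fun x => \sum_(k < n.+1) f k x *+ val I k) by [].
    by apply/funext => x; rewrite /m /= mul0r add0r.
  case: IH => [IH|[g hg gE]].
    exists m => // x; rewrite big_cons IH cI tmonomial_curve -EFinD.
    by rewrite /maxe ltNge leNye.
  exists (fun x => Num.max (m x) (g x)); first exact: convex_pl_max.
  by move=> x; rewrite big_cons gE cI tmonomial_curve -EFinD EFin_max.
have stepE x : \big[maxe/-oo%E]_(I <- I :: l)
   (coef P I + tmonomial I (curve_point f x))%E =
   \big[maxe/-oo%E]_(I <- l) (coef P I + tmonomial I (curve_point f x))%E.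
  by rewrite big_cons cI /= /maxe ltNye; case: eqP => //= ->.
case: IH => [IH|[g hg gE]]; [left|right; exists g => //] => x;
  by rewrite stepE.
Qed.

Lemma tcomp_le d (P : tpoly R n d) f :
  exists K, forall x, tcomp P f x <= d%:R * tnorm f x + K.
Proof.
exists (\sum_(I : expo n d) `|fine (coef P I)|) => x.
rewrite -lee_fin -teval_curve /teval; apply/bigmax_leP; split=> [|I _].
  by rewrite leNye.
rewrite tmonomial_curve.
have := coef_Rmax P I; case cI : (coef P I) => [c| |]// _; last first.
  by rewrite leNye.
rewrite -EFinD lee_fin addrC lerD ?monomial_le_tnorm// (bigD1 I)//= cI/=.
by rewrite (le_trans (ler_norm c))// lerDl sumr_ge0.
Qed.

Lemma symm_mean_tcomp_le d (P : tpoly R n d) f :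
  exists K, forall r, symm_mean (tcomp P f) r <= d%:R * Tchar f r + K.
Proof.
have [K hK] := tcomp_le P f.
exists (K - tcomp P f 0 + d%:R * tnorm f 0) => r.
have h1 := hK r; have h2 := hK (- r).
by rewrite /symm_mean /Tchar; lra.
Qed.

Lemma card_expo d : (#|{: expo n d}| <= 'C(n + d, d))%N.
Proof.
rewrite -(bin_sub (leq_addl n d)) addnK -card_ord_partitions.
pose F (I : expo n d) : n.+1.-tuple 'I_d.+1 := [tuple val I k | k < n.+1].
have Finj : injective F.
  move=> I J IJ; apply: val_inj; apply/ffunP => k.
  by have := congr1 (fun t => tnth t k) IJ; rewrite !tnth_mktuple.
rewrite -(card_imset _ Finj);
apply/subset_leq_card/fintype.subsetP => _ /finset.imsetP[I _ ->].
case: I => I hI; rewrite inE big_tuple; apply/eqP.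
transitivity (\sum_(k < n.+1) (I k : nat))%N; last exact/eqP.
by apply: eq_bigr => k _; rewrite tnth_mktuple.
Qed.

(** There are no more exponents than completeness requires in [S], so [S] contains them all and
    every pure power occurs with a real coefficient. *)
Lemma complete_ge d f (F : R -> R) : (0 < d)%N -> complete f d F ->
  exists K, forall x, d%:R * tnorm f x <= F x + K.
Proof.
move=> d0 [_ [S [cS [b hb]]] _].
have ST : S = [set: expo n d]%SET.
  apply/eqP; rewrite eqEcard finset.subsetT cS cardsT; exact: card_expo.
exists (\sum_(k < n.+1) `|b (pure d k)|) => x.
have Fk k : d%:R * f k x <= F x + \sum_(k < n.+1) `|b (pure d k)|.
  have : ((b (pure d k))%:E + tmonomial (pure d k) (curve_point f x) <= (F x)%:E)%E.
    rewrite hb ST.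
    apply: (@le_bigmax_cond _ _ _ _ _ (fun I => I \in [set: expo n d]%SET)
      (fun I => (b I)%:E + tmonomial I (curve_point f x))%E).
    by rewrite finset.in_setT.
  rewrite tmonomial_pure -EFinD lee_fin (bigD1 k)//=.
  have : - `|b (pure d k)| <= b (pure d k) by rewrite lerNl -normrN ler_norm.
  have : 0 <= \sum_(i < n.+1 | i != k) `|b (pure d i)| by exact: sumr_ge0.
  by lra.
have dpos : 0 < d%:R :> R by rewrite ltr0n.
rewrite -ler_pdivlMl//; apply/bigmax_leP; split=> [|k _];
  by rewrite ler_pdivlMl.
Qed.

(** If [Tchar f] were never positive, the norm and all [f k] would be affine with one common slope,
    so two coordinates would differ by a constant. The curve would then lie in the hypersurface of a
    binomial of degree 1. *)
Lemma Tchar_gt0 f : (0 < n)%N -> (forall k, convex_pl (f k)) ->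
  alg_nondegenerate f -> exists2 r, 0 < r & 0 < Tchar f r.
Proof.
move=> n0 hf hnd; apply: contrapT => Tle.
have T0 r : 0 <= r -> Tchar f r <= 0.
  rewrite le_eqVlt => /predU1P[<-|r0]; first by rewrite /Tchar oppr0; lra.
  by rewrite leNgt; apply/negP => Tr; apply: Tle; exists r.
have hT := convex_pl_tnorm hf.
have fk0 k s : 0 <= s -> symm_mean (f k) s <= 0.
  rewrite le_eqVlt => /predU1P[<-|s0]; first by rewrite /symm_mean oppr0; lra.
  rewrite leNgt; apply/negP => Js.
  have Jle r : 0 <= r -> symm_mean (f k) r <= tnorm f 0 - f k 0.
    move=> /T0; have := le_tnorm f k r; have := le_tnorm f k (- r).
    by rewrite /Tchar /symm_mean; lra.
  pose B := tnorm f 0 - f k 0.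
  have B0 : 0 <= B by rewrite subr_ge0 le_tnorm.
  (* A radius at which growth at the rate [symm_mean (f k) s / s] exceeds the bound [B]. *)
  pose r := (B * s) / symm_mean (f k) s + s + 1.
  have rs : s <= r.
    have : 0 <= (B * s) / symm_mean (f k) s.
      by rewrite divr_ge0 ?mulr_ge0// ltW.
    by rewrite /r; lra.
  have r0 : 0 <= r by lra.
  have := symm_mean_star (hf k) (ltW s0) rs.
  have : symm_mean (f k) r * s <= B * s by rewrite ler_wpM2r ?Jle// ltW.
  have : symm_mean (f k) s * r = B * s + symm_mean (f k) s * (s + 1).
    by rewrite /r; field; rewrite gt_eqF.
  have : 0 < symm_mean (f k) s * (s + 1) by rewrite mulr_gt0//; lra.
  by lra.
have aff k x : f k x = f k 0 + (tnorm f 1 - tnorm f 0) * x.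
  rewrite (symm_mean_eq0_affine x (hf k) (fk0 k)).
  suff -> : f k 1 - f k 0 = tnorm f 1 - tnorm f 0 by [].
  set a := f k 1 - f k 0; set a' := tnorm f 1 - tnorm f 0.
  have le_x y : f k 0 + a * y <= tnorm f 0 + a' * y.
    rewrite /a /a' -(symm_mean_eq0_affine y (hf k) (fk0 k)).
    by rewrite -(symm_mean_eq0_affine y hT T0) le_tnorm.
  apply/eqP; rewrite -subr_eq0; apply: contraT => da.
  (* If the slopes differed, the line of [f k] would exceed that of the norm by 1 at this point. *)
  have := le_x ((tnorm f 0 - f k 0 + 1) / (a - a')).
  suff : (a - a') * ((tnorm f 0 - f k 0 + 1) / (a - a')) =
    tnorm f 0 - f k 0 + 1 by lra.
  by field.
pose k1 : 'I_n.+1 := Ordinal (n0 : (1 < n.+1)%N).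
(* The tropical sum of [x_0] and of [x_1] shifted by [f_0 0 - f_1 0]; both terms equal [f_0] along
   the curve. *)
pose cf (I : expo n 1) : \bar R :=
  if I == pure 1 ord0 then 0%E else
  if I == pure 1 k1 then (f ord0 0 - f k1 0)%:E else -oo%E.
have cfR I : cf I != +oo%E by rewrite /cf; do 2 case: ifP => // _.
have cf0 : exists I, cf I != -oo%E by exists (pure 1 ord0); rewrite /cf eqxx.
have pure01 : pure 1 k1 != pure 1 ord0.
  apply/eqP => /(congr1 (fun I : expo n 1 => val (val I k1))).
  by rewrite /= !ffunE.
apply: (hnd 1 (TPoly cfR cf0)) => _ [x _ <-]; split.
  by split=> [k|]; [|exists ord0].
have t0 : (coef (TPoly cfR cf0) (pure 1 ord0) +
    tmonomial (pure 1 ord0) (curve_point f x) = (f ord0 x)%:E)%E.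
  by rewrite /= /cf eqxx tmonomial_pure mul1r add0e.
have t1 : (coef (TPoly cfR cf0) (pure 1 k1) +
    tmonomial (pure 1 k1) (curve_point f x) = (f ord0 x)%:E)%E.
  rewrite /= /cf (negbTE pure01) eqxx tmonomial_pure mul1r -EFinD.
  by rewrite (aff ord0 x) (aff k1 x); congr EFin; ring.
suff ev : teval (TPoly cfR cf0) (curve_point f x) = (f ord0 x)%:E.
  by exists (pure 1 k1), (pure 1 ord0); rewrite t0 t1 ev.
apply/eqP; rewrite eq_le; apply/andP; split; last by rewrite -t0; exact: le_bigmax.
apply/bigmax_leP; split=> [|I _]; first exact: leNye.
have [->|I0] := eqVneq I (pure 1 ord0); first by rewrite t0.
have [->|I1] := eqVneq I (pure 1 k1); first by rewrite t1.
by rewrite /= /cf (negbTE I0) (negbTE I1) /= leNye.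
Qed.

End Curves.

(** * The tropical Casoratian compared with the sum of its entries *)

Section Casoratian.
Context {R : realType}.
Context (c : R) (M : nat) (g : 'I_M.+1 -> R -> R).

Lemma convex_pl_casoratian :
  (forall k, convex_pl (g k)) -> convex_pl (casoratian c g).
Proof.
move=> hg.
have hterm s : convex_pl (fun x => casoratian_term c g x s).
  apply: (@convex_pl_sum _ _ _ (fun k x => g k (x + (s k)%:R * c))) => k.
  exact: convex_pl_shift.
exact: (convex_pl_bigmax _ (hterm 1%g) hterm).
Qed.

(** The bound holds for the term of each permutation, the default one included, and [max] returns
    one of its arguments. *)
Lemma casoratian_dist x (D : 'I_M.+1 -> R) :
  (forall k (j : 'I_M.+1), `|g k (x + j%:R * c) - g k x| <= D k) ->
  `|casoratian c g x - \sum_(k < M.+1) g k x| <= \sum_(k < M.+1) D k.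
Proof.
move=> hD.
have hterm s : `|casoratian_term c g x s - \sum_(k < M.+1) g k x| <=
    \sum_(k < M.+1) D k.
  rewrite /casoratian_term -sumrB; apply: le_trans (ler_norm_sum _ _ _) _.
  by apply: ler_sum => k _; exact: hD.
rewrite /casoratian; elim/big_ind: _ => // u v hu hv.
by rewrite /Num.max; case: ifP.
Qed.

End Casoratian.

(** * Asymptotic relations outside an exceptional set *)

Section Asymptotics.
Context {R : realType}.
Implicit Types (E : set R) (T A B : R -> R).

Lemma near_infty_outside E (Q : R -> Prop) :
  (exists r0, forall r, r0 < r -> ~ E r -> Q r) ->
  \forall r \near infty_outside E, Q r.
Proof.
move=> [r0 hr0]; exists r0; split; first exact: num_real.
by move=> r r0r; exact: hr0.
Qed.

(** The remainder is the positive part of [A - B], since [A - B] itself may be far below zero. *)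
Lemma le_o_of E T A B :
  (forall e, 0 < e -> exists r0, forall r, r0 < r -> ~ E r ->
     A r - B r <= e * `|T r|) -> le_o E T A B.
Proof.
move=> hAB; exists (fun r => Num.max 0 (A r - B r)).
  apply/eqoP => e e0; apply: near_infty_outside.
  have [r0 hr0] := hAB _ e0; exists r0 => r r0r nE.
  rewrite ger0_norm ?le_max ?lexx// ge_max hr0// andbT.
  by rewrite mulr_ge0// ltW.
apply: near_infty_outside; exists 0 => r _ _.
have : A r - B r <= Num.max 0 (A r - B r) by rewrite le_max lexx orbT.
by lra.
Qed.

Lemma eq_o_of E T A B :
  (forall e, 0 < e -> exists r0, forall r, r0 < r -> ~ E r ->
     `|A r - B r| <= e * `|T r|) -> eq_o E T A B.
Proof.
move=> hAB; exists (fun r => A r - B r).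
  by apply/eqoP => e e0; apply: near_infty_outside; exact: hAB.
by apply: near_infty_outside; exists 0 => r _ _; ring.
Qed.

Lemma limf_esup_pinfty_le0 (phi : R -> R) e :
  limf_esup (fun r => (phi r)%:E) (pinfty_nbhs R) = 0%E -> 0 < e ->
  exists r0, forall r, r0 < r -> phi r <= e.
Proof.
move=> h0 e0.
have : (limf_esup (fun r => (phi r)%:E) (pinfty_nbhs R) < e%:E)%E.
  by rewrite h0 lte_fin.
rewrite /limf_esup => /ereal_inf_lt[_ [V [r0 [_ r0V]] <-]] Ve.
exists r0 => r r0r; rewrite -lee_fin; apply/ltW/le_lt_trans/Ve.
by apply: ereal_sup_ubound; exists r => //; exact: r0V.
Qed.

End Asymptotics.

(** * Error terms relative to the characteristic function *)

Section SecondMainTheorem.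
Context {R : realType} {n : nat} (f : 'I_n.+1 -> R -> R).
Context (hn : (0 < n)%N) (hf : forall k, convex_pl (f k)).
Context (hnd : alg_nondegenerate f).

Lemma Tchar_ge0 r : 0 <= r -> 0 <= Tchar f r.
Proof. exact/symm_mean_ge0/convex_pl_tnorm. Qed.

Lemma Tchar_nondecreasing x y : 0 <= x -> x <= y -> Tchar f x <= Tchar f y.
Proof. exact/symm_mean_nondecreasing/convex_pl_tnorm. Qed.

(** One positive value [Tchar f s] and [symm_mean_star] give at least linear growth, so every
    constant is [o(T)]. *)
Lemma Tchar_dominates K e : 0 < e ->
  exists r0, forall r, r0 < r -> K <= e * Tchar f r.
Proof.
move=> e0; have [s s0 Ts] := Tchar_gt0 hn hf hnd.
exists (`|K| * s / (e * Tchar f s) + s) => r rs.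
have eT : 0 < e * Tchar f s by exact: mulr_gt0.
have K0 : 0 <= `|K| * s / (e * Tchar f s).
  by apply: divr_ge0; [apply: mulr_ge0 => //; exact: ltW|exact: ltW].
apply: le_trans (ler_norm K) _; rewrite -(ler_pM2r s0).
have sr : s <= r by lra.
have := symm_mean_star (convex_pl_tnorm hf) (ltW s0) sr.
rewrite -!Tchar_symm_mean => Tsr.
have h1 : `|K| * s / (e * Tchar f s) <= r by lra.
rewrite ler_pdivrMr// in h1.
apply: le_trans h1 _.
have : e * (Tchar f s * r) <= e * (Tchar f r * s) by rewrite ler_pM2l.
lra.
Qed.

(* The increments of all the [g k] are dominated by those of the single function
   [W = 1 + T + sum_k symm_mean (g k)], which grows as slowly as [T]. *)
Lemma casoratian_symm_mean_small (c : R) (M : nat) (g : 'I_M.+1 -> R -> R)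
    (D : 'I_M.+1 -> R) :
  c != 0 ->
  (forall k, convex_pl (g k)) ->
  (forall k, exists K, forall r, symm_mean (g k) r <= D k * Tchar f r + K) ->
  limf_esup (fun r : R => (ln (Tchar f r) / r)%:E) (pinfty_nbhs R) = 0%E ->
  exists2 E : set R, zero_upper_density E &
    forall e, 0 < e -> exists r0, forall r, r0 < r -> ~ E r ->
      `|\sum_(k < M.+1) symm_mean (g k) r - symm_mean (casoratian c g) r| <=
        e * Tchar f r.
Proof.
move=> c0 hg /choice[K hK] hlim.
pose S r := \sum_(k < M.+1) symm_mean (g k) r.
pose W r := 1 + Tchar f r + S r.
have S0 r : 0 <= r -> 0 <= S r.
  by move=> r0; apply: sumr_ge0 => k _; exact: symm_mean_ge0.
have Snd x y : 0 <= x -> x <= y -> S x <= S y.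
  by move=> x0 xy; apply: ler_sum => k _; exact: symm_mean_nondecreasing.
have Wnd x y : 0 <= x -> x <= y -> W x <= W y.
  by move=> x0 xy; rewrite /W lerD ?Snd// lerD ?Tchar_nondecreasing.
have W1 x : 0 <= x -> 1 <= W x.
  by move=> x0; have := Tchar_ge0 x0; have := S0 _ x0; rewrite /W; lra.
(* The constants in [W] add up to at most [1 + \sum_k K k], which is eventually below [T]; this
   accounts for one of the two 1s in [kap]. *)
have [kap kap0 [rk hrk]] : exists2 kap, 0 < kap &
    exists r0, forall r, r0 < r -> W r <= kap * Tchar f r.
  exists (1 + 1 + `|\sum_k D k|); first by have := normr_ge0 (\sum_k D k) => ?; lra.
  have [r0 hr0] := Tchar_dominates (1 + \sum_k K k) ltr01.
  exists (Num.max 0 r0) => r; rewrite gt_max => /andP[rpos rr0].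
  have SD : S r <= (\sum_k D k) * Tchar f r + \sum_k K k.
    by rewrite mulr_suml -big_split; apply: ler_sum => k _; exact: hK.
  have : (\sum_k D k) * Tchar f r <= `|\sum_k D k| * Tchar f r.
    by rewrite ler_wpM2r ?ler_norm// Tchar_ge0// ltW.
  by have := hr0 _ rr0; rewrite /W; lra.
have Wln e : 0 < e -> exists r0, forall r, r0 < r -> ln (W r) <= e * r.
  move=> e0; have e20 : 0 < e / 2 by lra.
  have [r1 hr1] := limf_esup_pinfty_le0 hlim e20.
  exists (Num.max (Num.max r1 rk) (Num.max 0 (ln kap / (e / 2)))) => r.
  rewrite !gt_max => /andP[/andP[rr1 rrk] /andP[r0 rln]].
  have W0 : 0 < W r by apply: lt_le_trans ltr01 (W1 _ _); exact: ltW.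
  have kT : 0 < kap * Tchar f r by exact: lt_le_trans (hrk _ rrk).
  have T0 : 0 < Tchar f r by rewrite -(pmulr_rgt0 _ kap0).
  have lnT : ln (Tchar f r) <= e / 2 * r by rewrite -ler_pdivrMr// hr1.
  have lnk : ln kap <= e / 2 * r by rewrite ltW// mulrC -ltr_pdivrMr.
  have : ln (W r) <= ln (kap * Tchar f r) by rewrite ler_ln ?posrE// hrk.
  by rewrite lnM ?posrE//; lra.
(* A step that dominates all shifts [j * c] with [j <= M]. *)
pose s := M.+1%:R * `|c|.
have s0 : 0 < s by rewrite mulr_gt0 ?ltr0n// normr_gt0.
have [E zE hE] := small_increments s0 Wnd W1 Wln.
exists E => // e e0.
have [L hL] := choice (fun k => convex_pl_increment (hg k) s0).
pose L0 := \sum_k L k + `|casoratian c g 0 - \sum_k g k 0|.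
(* The increment of [W] enters with factor 2 and [W <= kap * T], giving [e / 2 * T]; the other half
   pays for [L0]. *)
have ek0 : 0 < e / (4 * kap) by rewrite divr_gt0 ?mulr_gt0.
have [r1 hr1] := hE _ ek0.
have e20 : 0 < e / 2 by lra.
have [r2 hr2] := Tchar_dominates L0 e20.
exists (Num.max (Num.max r1 r2) (Num.max s rk)) => r.
rewrite !gt_max => /andP[/andP[rr1 rr2] /andP[rs rrk]] nEr.
have r0 : 0 <= r by lra.
have jcs (j : 'I_M.+1) : `|j%:R * c| <= s.
  by rewrite normrM normr_nat ler_wpM2r// ler_nat ltnW.
have cp := casoratian_dist (fun k j => (hL k r (j%:R * c) (ltW rs) (jcs j)).1).
have cm := casoratian_dist (fun k j => (hL k r (j%:R * c) (ltW rs) (jcs j)).2).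
have sumD : \sum_(k < M.+1)
    (2 * (symm_mean (g k) (r + s) - symm_mean (g k) r) + L k) =
    2 * (S (r + s) - S r) + \sum_k L k.
  by rewrite big_split /= -mulr_sumr sumrB.
rewrite sumD in cp cm.
have SW : S (r + s) - S r <= W (r + s) - W r.
  have rrs : r <= r + s by lra.
  by have := Tchar_nondecreasing r0 rrs; rewrite /W; lra.
have Wk : e / (4 * kap) * W r <= e / 4 * Tchar f r.
  have -> : e / 4 * Tchar f r = e / (4 * kap) * (kap * Tchar f r).
    by field; rewrite gt_eqF.
  by rewrite ler_pM2l// hrk.
have WW := hr1 _ rr1 nEr.
have LT := hr2 _ rr2.
have -> : \sum_(k < M.+1) symm_mean (g k) r =
    2^-1 * (\sum_k g k r + \sum_k g k (- r)) - \sum_k g k 0.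
  by rewrite /symm_mean sumrB -mulr_sumr big_split.
move: cp cm LT; rewrite /L0 /symm_mean.
move: (\sum_k g k r) (\sum_k g k (- r)) (\sum_k g k 0) (\sum_k L k).
move=> gp gm g0 Ls.
move: (casoratian c g r) (casoratian c g (- r)) (casoratian c g 0).
move=> Cp Cm C0; rewrite !ler_norml => /andP[p1 p2] /andP[m1 m2] LT.
have n1 := ler_norm (C0 - g0).
have n2 : g0 - C0 <= `|C0 - g0| by rewrite -normrN (le_trans _ (ler_norm _))// opprB.
by apply/andP; split; lra.
Qed.

End SecondMainTheorem.

Theorem theorem4p8 (R : realType) (q n : nat)
  (hq : (0 < q)%N) (hn : (0 < n)%N) (hnq : (n <= q)%N)
  (f : 'I_n.+1 -> R -> R)
  (hf : reduced_representation f)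
  (hnd : alg_nondegenerate f)
  (dg : 'I_q -> nat) (hdg : forall j, (0 < dg j)%N)
  (P : forall j : 'I_q, tpoly R n (dg j))
  (d : nat) (hd : d = \big[lcmn/1%N]_(j < q) dg j)
  (M : nat) (hM : M = ('C(n + d, d) - 1)%N) (hMq : (M.+1 <= q)%N)
  (c : R) (hc : c != 0)
  (lam : nat)
  (hlam : lam = ddg f d [set j : 'I_q | (M.+1 <= j)%N]%SET
                  (fun j => tpow (tcomp (P j) f) (d %/ dg j)))
  (hlim : limf_esup (fun r : R => (ln (Tchar f r) / r)%:E) (pinfty_nbhs R) = 0%E) :
  let T := Tchar f in
  let C := casoratian c (fun k : 'I_M.+1 =>
             let j := widen_ord hMq k in tpow (tcomp (P j) f) (d %/ dg j)) in
  let A := fun r : R =>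
    \sum_(j < q) (dg j)%:R^-1 * Ncount r (tinv (tcomp (P j) f))
    - d%:R^-1 * Ncount r (tinv C) in
  let B := fun r : R =>
    \sum_(j < q | (M.+1 <= j)%N) (dg j)%:R^-1 * Ncount r (tinv (tcomp (P j) f)) in
  (exists E : set R, zero_upper_density E /\
     [/\ le_o E T (fun r => (q%:R - M%:R - 1 - lam%:R) * T r) A,
         eq_o E T A B &
         le_o E T B (fun r => (q%:R - M%:R - 1) * T r)])
  /\
  (lam = 0%N ->
   exists E : set R, zero_upper_density E /\
     (eq_o E T (fun r => (q%:R - M%:R - 1) * T r) A /\ eq_o E T A B)).
Proof.
move=> T C A B.
have hfc k : convex_pl (f k) by exact/tropical_entire_convex_pl/hf.1.
have hP j : convex_pl (tcomp (P j) f) by exact: convex_pl_tcomp.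
have NE j r : 0 <= r -> Ncount r (tinv (tcomp (P j) f)) =
    symm_mean (tcomp (P j) f) r by exact: Ncount_tinv.
have T0 r : 0 <= r -> 0 <= T r by exact: Tchar_ge0.
have dvd j : (dg j %| d)%N by rewrite hd (bigD1 j)//= dvdn_lcml.
have d0 : (0 < d)%N.
  by rewrite hd; elim/big_ind: _ => // x y x0 y0; rewrite lcmn_gt0 x0.
have dR : 0 < d%:R :> R by rewrite ltr0n.
have dgR j : 0 < (dg j)%:R :> R by rewrite ltr0n.
have dE j : d%:R = (d %/ dg j)%:R * (dg j)%:R :> R.
  by rewrite -natrM divnK.
have M1 : M.+1 = 'C(n + d, d).
  by rewrite hM subn1 prednK// bin_gt0 leq_addl.
pose g (k : 'I_M.+1) := tpow (tcomp (P (widen_ord hMq k)) f)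
                             (d %/ dg (widen_ord hMq k)).
have hg k : convex_pl (g k) by apply: convex_plZ => //; exact: ler0n.
have hC : convex_pl C by exact: convex_pl_casoratian.
have gE k r : symm_mean (g k) r =
    (d %/ dg (widen_ord hMq k))%:R * symm_mean (tcomp (P (widen_ord hMq k)) f) r.
  by rewrite /symm_mean /g /tpow; ring.
have gle k : exists K, forall r, symm_mean (g k) r <= d%:R * Tchar f r + K.
  have [K hK] := symm_mean_tcomp_le (P (widen_ord hMq k)) f.
  exists ((d %/ dg (widen_ord hMq k))%:R * K) => r.
  by rewrite gE (dE (widen_ord hMq k)) -mulrA -mulrDr ler_wpM2l.
have [E zE hE] := casoratian_symm_mean_small hn hfc hnd hc hg gle hlim.
(* The terms with [M + 1 <= j] cancel. In each remaining one, division by [d_j] amounts to division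
   by [d] after passing to the power [g k], so the difference is the Casoratian error over [d]. *)
have AB r : 0 <= r -> A r - B r =
    d%:R^-1 * (\sum_(k < M.+1) symm_mean (g k) r - symm_mean C r).
  move=> r0; rewrite [RHS]mulrBr mulr_sumr /A /B.
  rewrite (bigID (fun j : 'I_q => (M.+1 <= j)%N))/=.
  rewrite (Ncount_tinv hC r0).
  rewrite [X in _ + X - _ - _](eq_bigl (fun j : 'I_q => (j < M.+1)%N)); last first.
    by move=> j; rewrite -ltnNge.
  rewrite [X in _ + X - _ - _](big_ord_narrow hMq).
  suff -> : \sum_(i < M.+1) (dg (widen_ord hMq i))%:R^-1 *
      Ncount r (tinv (tcomp (P (widen_ord hMq i)) f)) =
    \sum_(i < M.+1) d%:R^-1 * symm_mean (g i) r by rewrite /symm_mean; ring.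
  apply: eq_bigr => k _; rewrite NE// gE (dE (widen_ord hMq k)).
  field; rewrite !gt_eqF// ltr0n divn_gt0// dvdn_leq//.
have ABsmall e : 0 < e -> exists r0, forall r, r0 < r -> ~ E r ->
    `|A r - B r| <= e * T r.
  move=> e0; have [r0 hr0] := hE _ (mulr_gt0 dR e0).
  exists (Num.max 0 r0) => r; rewrite gt_max => /andP[rpos rr0] nE.
  rewrite AB; last exact: ltW.
  rewrite normrM gtr0_norm ?invr_gt0// ler_pdivrMl// mulrA.
  exact: hr0.
(* Indices start at 0, so [M + 1 <= j] selects the polynomials numbered [M + 2] to [q] from 1. *)
have count : \sum_(j < q | (M.+1 <= j)%N) 1 = q%:R - M%:R - 1 :> R.
  have : \sum_(j < q) 1 = q%:R :> R by rewrite sumr_const card_ord.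
  rewrite (bigID (fun j : 'I_q => (M.+1 <= j)%N))/=.
  rewrite [X in _ + X](eq_bigl (fun j : 'I_q => (j < M.+1)%N)); last first.
    by move=> j; rewrite -ltnNge.
  rewrite (big_ord_narrow hMq) [X in _ + X]sumr_const card_ord -[M.+1%:R]natr1; lra.
have [K1 hK1] : exists K, forall r, 0 <= r ->
    B r <= (q%:R - M%:R - 1) * T r + K.
  have /choice[K hK] j := symm_mean_tcomp_le (P j) f.
  exists (\sum_(j < q | (M.+1 <= j)%N) (dg j)%:R^-1 * K j) => r r0.
  rewrite -count mulr_suml -big_split/=; apply: ler_sum => j _.
  by rewrite mul1r NE// ler_pdivrMl// mulrDr mulrA divff ?gt_eqF// mul1r.
pose Q j := complete f d (tpow (tcomp (P j) f) (d %/ dg j)).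
(* Termwise: a complete composition contributes [T] up to a constant, any other one a nonnegative
   count. *)
have [K2 hK2] : exists K, forall r, 0 <= r ->
    (q%:R - M%:R - 1 - lam%:R) * T r <= B r + K.
  have /choice[K hK] j : exists K, Q j -> forall r, 0 <= r ->
      T r <= (dg j)%:R^-1 * symm_mean (tcomp (P j) f) r + K.
    have [Qj|nQj] := pselect (Q j); last by exists 0.
    have [K hK] := complete_ge d0 Qj.
    exists (d%:R^-1 * K + (dg j)%:R^-1 * tcomp (P j) f 0 - tnorm f 0) => _ r r0.
    have bound x : tnorm f x <= (dg j)%:R^-1 * tcomp (P j) f x + d%:R^-1 * K.
      rewrite -(ler_pM2l dR); apply: le_trans (hK x) _.
      rewrite /tpow mulrDr mulrA (mulrA d%:R) divff ?gt_eqF// mul1r lerD2r.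
      by rewrite (dE j) mulfK ?gt_eqF.
    have h1 := bound r; have h2 := bound (- r).
    by rewrite /T /Tchar /symm_mean; lra.
  (* At a non-complete index [K j] is arbitrary; the maximum with 0 keeps its contribution
     nonnegative. *)
  exists (\sum_(j < q | (M.+1 <= j)%N) Num.max 0 (K j)) => r r0.
  have lamE : lam%:R =
      \sum_(j < q | (M.+1 <= j)%N) (if `[< Q j >] then 0 else 1) :> R.
    rewrite hlam /ddg -sum1_card natr_sum.
    rewrite (eq_bigl (fun j : 'I_q => (M.+1 <= j)%N && ~~ `[< Q j >])); last first.
      by move=> j; rewrite !inE.
    by rewrite big_mkcondr; apply: eq_bigr => j _; rewrite if_neg.
  rewrite lamE -count -sumrB mulr_suml -big_split; apply: ler_sum => j _ /=.
  rewrite NE//; have maxK : 0 <= Num.max 0 (K j) by rewrite le_max lexx.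
  have KK : K j <= Num.max 0 (K j) by rewrite le_max lexx orbT.
  have [Qj|nQj] := asboolP (Q j).
    by rewrite subr0 mul1r; have := hK _ Qj _ r0; lra.
  by rewrite subrr mul0r addr_ge0// mulr_ge0 ?invr_ge0 ?ler0n ?symm_mean_ge0.
have absT r : 0 <= r -> `|T r| = T r by move=> /T0/ger0_norm.
have eqAB : eq_o E T A B.
  apply: eq_o_of => e e0; have [r0 hr0] := ABsmall _ e0.
  exists (Num.max 0 r0) => r; rewrite gt_max => /andP[rpos rr0] nE.
  by rewrite (absT _ (ltW rpos)) hr0.
have lowA e : 0 < e -> exists r0, forall r, r0 < r -> ~ E r ->
    (q%:R - M%:R - 1 - lam%:R) * T r - A r <= e * `|T r|.
  move=> e0; have e20 : 0 < e / 2 by lra.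
  have [r1 hr1] := ABsmall _ e20.
  have [r2 hr2] := Tchar_dominates hn hfc hnd K2 e20.
  exists (Num.max 0 (Num.max r1 r2)) => r.
  rewrite !gt_max => /andP[rpos /andP[rr1 rr2]] nE.
  rewrite (absT _ (ltW rpos)); have := hr1 _ rr1 nE; rewrite ler_norml => /andP[h1 _].
  by have := hr2 _ rr2; have := hK2 _ (ltW rpos); rewrite -/T; lra.
have highB e : 0 < e -> exists r0, forall r, r0 < r -> ~ E r ->
    B r - (q%:R - M%:R - 1) * T r <= e * `|T r|.
  move=> e0; have [r1 hr1] := Tchar_dominates hn hfc hnd K1 e0.
  exists (Num.max 0 r1) => r; rewrite gt_max => /andP[rpos rr1] nE.
  rewrite (absT _ (ltW rpos)); have := hr1 _ rr1; have := hK1 _ (ltW rpos).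
  by rewrite -/T; lra.
split.
  exists E; split=> //; split=> //; exact: le_o_of.
(* With [lam = 0] the lower bound for [A] and the upper bound for [B] share their main term, and
   [A - B] is small, so they close up to an equality outside the same set. *)
move=> lam0; exists E; split=> //; split=> //.
apply: eq_o_of => e e0; have e20 : 0 < e / 2 by lra.
have [r1 hr1] := lowA _ e0.
have [r2 hr2] := highB _ e20.
have [r3 hr3] := ABsmall _ e20.
exists (Num.max (Num.max 0 r1) (Num.max r2 r3)) => r.
rewrite !gt_max => /andP[/andP[rpos rr1] /andP[rr2 rr3]] nE.
have := hr1 _ rr1 nE; have := hr2 _ rr2 nE; have := hr3 _ rr3 nE.
rewrite lam0 (absT _ (ltW rpos)) !ler_norml => /andP[h1 h2] h3 h4.
by apply/andP; split; lra.
Qed.
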